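(* Suppose $f(i,y,z)$ is concave in $(y,z)$. Fix $i\in\{0,\ldots,n\}$. For $\tau\in\bar{\mathcal S}_i$ and $(M^0,M)\in\mathcal M_{1+D}$ define $\vartheta^{low}_j=\vartheta^{low}_j(\tau,M^0,M)$ for $i\le j\le\tau$ pathwise by $\vartheta^{low}_\tau=S_\tau$ and, for $i\le j<\tau$, as the unique solution of $$\vartheta^{low}_j=\vartheta^{low}_{j+1}-(M^0_{j+1}-M^0_j)+f\big(j,\vartheta^{low}_j,\beta_{j+1}\vartheta^{low}_{j+1}-(M_{j+1}-M_j)\big)\Delta_j.$$ Then $$Y_i=\operatorname*{ess\,sup}_{\tau\in\bar{\mathcal S}_i}\ \operatorname*{ess\,sup}_{(M^0,M)\in\mathcal M_{1+D}}E_i[\vartheta^{low}_i(\tau,M^0,M)],$$ and a maximizer, even pathwise optimal ($\vartheta^{low}_i(\tau^*_i,M^{0,*},M^* )=Y_i$ a.s.), is $(\tau^*_i,M^{0,*},M^* )$, where $M^{0,*}$ and $M^*$ are the Doob martingales of $Y$ and of $(\beta_jY_j)_j$ (with $\beta_0:=0$).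
   Context: Standing setting: $n\ge 1$ and $D\ge 1$ are integers; $(\Omega,\mathcal F,(\mathcal F_i)_{i=0,\ldots,n},P)$ is a filtered probability space and $E_i[\cdot]=E[\cdot\mid\mathcal F_i]$. The constants $\Delta_0,\ldots,\Delta_{n-1}$ are positive reals. $S=(S_i)_{i=0,\ldots,n}$ is an adapted process with values in $\mathbb R\cup\{-\infty\}$, $S_n$ real-valued, with $\sum_{i=0}^{n-1}E[|S_i\mathbf 1_{\{S_i>-\infty\}}|]+E[|S_n|]<\infty$. The random field $f:\Omega\times\{0,\ldots,n-1\}\times\mathbb R\times\mathbb R^D\to\mathbb R$ is measurable, $f(\cdot,i,y,z)$ is $\mathcal F_i$-measurable for every $(y,z)$ (the dependence on $\omega$ is suppressed), $\sum_{i=0}^{n-1}E[|f(i,0,0)|]<\infty$, and there are adapted nonnegative processes $\alpha^{(0)},\ldots,\alpha^{(D)}$ with $|f(i,y,z)-f(i,y',z')|\le\alpha^{(0)}_i|y-y'|+\sum_{d=1}^D\alpha^{(d)}_i|z_d-z'_d|$ for all $(y,z),(y',z')\in\mathbb R\times\mathbb R^D$. $\beta=(\beta_i)_{i=1,\ldots,n}$ is a bounded adapted $\mathbb R^D$-valued process, and for $i=0,\ldots,n-1$ almost surely $\alpha^{(0)}_i<1/\Delta_i$ and $\sum_{d=1}^D\alpha^{(d)}_i|\beta_{d,i+1}|\le 1/\Delta_i$. $Y$ denotes the unique adapted integrable process with $Y_n=S_n$ and $Y_i=\max\{S_i,\;E_i[Y_{i+1}]+f(i,Y_i,E_i[\beta_{i+1}Y_{i+1}])\Delta_i\}$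 for $i=0,\ldots,n-1$. $\bar{\mathcal S}_i$ is the set of stopping times $\tau$ with $\tau\ge i$ and $S_\tau>-\infty$. $\tau^*_i:=\inf\{j\ge i:\; S_j\ge E_j[Y_{j+1}]+f(j,Y_j,E_j[\beta_{j+1}Y_{j+1}])\Delta_j\}\wedge n$. The Doob martingale of an integrable adapted process $V$ is $N_i=\sum_{j=0}^{i-1}(V_{j+1}-E_j[V_{j+1}])$. $\mathcal M_{1+D}$ is the set of pairs $(M^0,M)$ where $M^0$ is a real-valued martingale and $M=(M_1,\ldots,M_D)$ an $\mathbb R^D$-valued martingale with $\sum_{d=1}^D\sum_{i=0}^{n-1}E[\alpha^{(d)}_i|M_{d,i+1}-M_{d,i}|]\Delta_i<\infty$. *)

(* Defs.v *)
From mathcomp Require Import all_boot all_order all_algebra.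
From mathcomp Require Import all_classical all_reals all_analysis.
From mathcomp Require Import measurable_realfun.
Unset Printing Implicit Defensive.
Import Order.TTheory GRing.Theory Num.Theory.
Local Open Scope classical_set_scope.
Local Open Scope ring_scope.

Section Defs.
Context {R : realType} {d : measure_display} {T : measurableType d}.

Definition measurable_wrt (G : set (set T)) {d' : measure_display}
  {U : measurableType d'} (X : T -> U) : Prop :=
  forall B : set U, measurable B -> G (X @^-1` B).

Definition filtration (n : nat) (F : nat -> set (set T)) : Prop :=
  (forall i, (i <= n)%N -> sigma_algebra setT (F i)) /\
  (forall i A, (i <= n)%N -> F i A -> measurable A) /\
  (forall i j, (i <= j <= n)%N -> F i `<=` F j).

Definition cond_exp_op (P : probability T R) (n : nat) (F : nat -> set (set T))
  (CE : nat -> (T -> \bar R) -> T -> \bar R) : Prop :=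
  forall i (X : T -> \bar R), (i <= n)%N ->
    measurable_fun setT X -> (forall w, (0 <= X w)%E) ->
    [/\ measurable_wrt (F i) (CE i X), (forall w, (0 <= CE i X w)%E) &
        forall A, F i A -> (\int[P]_(w in A) CE i X w = \int[P]_(w in A) X w)%E].

(** generalized conditional expectation E_i[X] := E_i[X^+] - E_i[X^-]
   (for integrable X this is the usual one; where both parts are +oo the
   value is -oo, the mathcomp convention +oo + -oo = -oo) *)
Definition condE (CE : nat -> (T -> \bar R) -> T -> \bar R) (i : nat)
  (X : T -> \bar R) : T -> \bar R :=
  fun w => (CE i (X ^\+)%E w - CE i (X ^\-)%E w)%E.

Definition condER (CE : nat -> (T -> \bar R) -> T -> \bar R) (i : nat)
  (X : T -> R) : T -> R := fun w => fine (condE CE i (EFin \o X) w).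

Definition adapted_upto (n : nat) (F : nat -> set (set T)) (X : nat -> T -> R) :=
  forall i, (i <= n)%N -> measurable_wrt (F i) (X i).

Definition integrable_rv (P : probability T R) (X : T -> R) :=
  P.-integrable setT (EFin \o X).

Definition martingale (P : probability T R) (n : nat) (F : nat -> set (set T))
  (CE : nat -> (T -> \bar R) -> T -> \bar R) (M : nat -> T -> R) : Prop :=
  adapted_upto n F M /\ (forall j, (j <= n)%N -> integrable_rv P (M j)) /\
  forall j, (j < n)%N -> {ae P, forall w, M j w = condER CE j (M j.+1) w}.

Definition mart_pairs (P : probability T R) (n D : nat) (F : nat -> set (set T))
  (CE : nat -> (T -> \bar R) -> T -> \bar R) (alpha : 'I_D -> nat -> T -> R)
  (M0 : nat -> T -> R) (M : nat -> T -> 'I_D -> R) : Prop :=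
  martingale P n F CE M0 /\
  (forall k : 'I_D, martingale P n F CE (fun j w => M j w k)) /\
  (forall (k : 'I_D) j, (j < n)%N ->
     integrable_rv P (fun w => alpha k j w * `|M j.+1 w k - M j w k|)).

Definition stopping_time (n : nat) (F : nat -> set (set T)) (tau : T -> nat) :=
  (forall w, (tau w <= n)%N) /\ (forall j, (j <= n)%N -> F j [set w | tau w = j]).

Definition barS (n : nat) (F : nat -> set (set T)) (S : nat -> T -> \bar R)
  (i : nat) (tau : T -> nat) : Prop :=
  stopping_time n F tau /\ (forall w, (i <= tau w)%N) /\
  (forall w, S (tau w) w != -oo%E).

Definition doob (CE : nat -> (T -> \bar R) -> T -> \bar R) (V : nat -> T -> R)
  (i : nat) (w : T) : R :=
  \sum_(j < i) (V j.+1 w - condER CE j (V j.+1) w).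

Definition cont_value {D : nat} (CE : nat -> (T -> \bar R) -> T -> \bar R)
  (f : T -> nat -> R -> ('I_D -> R) -> R) (beta : nat -> T -> 'I_D -> R)
  (Delta : nat -> R) (Y : nat -> T -> R) (j : nat) (w : T) : R :=
  condER CE j (Y j.+1) w
  + f w j (Y j w) (fun k => condER CE j (fun w' => beta j.+1 w' k * Y j.+1 w') w)
    * Delta j.

Definition tau_star (n : nat) {D : nat} (CE : nat -> (T -> \bar R) -> T -> \bar R)
  (S : nat -> T -> \bar R) (f : T -> nat -> R -> ('I_D -> R) -> R)
  (beta : nat -> T -> 'I_D -> R) (Delta : nat -> R) (Y : nat -> T -> R)
  (i : nat) (w : T) : nat :=
  head n [seq j <- iota i (n - i) |
          ((cont_value CE f beta Delta Y j w)%:E <= S j w)%E].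

Definition theta_low (P : probability T R) {D : nat} (S : nat -> T -> \bar R)
  (f : T -> nat -> R -> ('I_D -> R) -> R) (beta : nat -> T -> 'I_D -> R)
  (Delta : nat -> R) (i : nat) (tau : T -> nat) (M0 : nat -> T -> R)
  (M : nat -> T -> 'I_D -> R) (theta : nat -> T -> R) : Prop :=
  (forall j, measurable_fun setT (theta j)) /\
  {ae P, forall w,
     (theta (tau w) w)%:E = S (tau w) w /\
     forall j, (i <= j)%N -> (j < tau w)%N ->
       theta j w = theta j.+1 w - (M0 j.+1 w - M0 j w)
         + f w j (theta j w)
             (fun k => beta j.+1 w k * theta j.+1 w - (M j.+1 w k - M j w k))
           * Delta j}.

Definition is_ess_sup (P : probability T R) (Fam : set (T -> \bar R))
  (Z : T -> \bar R) : Prop :=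
  measurable_fun setT Z /\
  (forall X, Fam X -> {ae P, forall w, (X w <= Z w)%E}) /\
  (forall Z', measurable_fun setT Z' ->
     (forall X, Fam X -> {ae P, forall w, (X w <= Z' w)%E}) ->
     {ae P, forall w, (Z w <= Z' w)%E}).

End Defs.

(* Main.v *)
Require Import Defs.
From mathcomp Require Import all_boot all_order all_algebra.
From mathcomp Require Import all_classical all_reals all_analysis.
From mathcomp Require Import measurable_realfun.
From mathcomp Require Import zify ring lra.
Import Order.TTheory GRing.Theory Num.Theory.
Import numFieldNormedType.Exports HBNNSimple.
Local Open Scope classical_set_scope.
Local Open Scope ring_scope.

(** The driver [f], linearized at [(Y_j, E_j[beta Y])] by a supergradient, turns the
    recursion for [theta_j - Y_j] on [i <= j < tau] into
    [theta_j - Y_j <= a_j (b_j (theta_{j+1} - Y_{j+1}) - xi_{j+1})], where the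
    contraction hypothesis gives [a_j, b_j >= 0] and [xi] is built from martingale
    increments. As [theta_tau <= Y_tau], this yields [theta_i <= Y_i - N_n] for a
    martingale transform [N] started at 0. Nothing makes [theta_i] or [N_n] integrable a
    priori; but on an event of [F_i] where the negative part of [theta_i] is integrable,
    [N_n] has an integrable positive part, and a discrete-time local martingale with this
    property is a true martingale, so that [E_i[theta_i] <= Y_i] there. Everywhere else
    the generalized conditional expectation is [-oo]. Equality is attained because [Y]
    itself solves the recursion driven by its Doob martingales up to [tau*]; the solution
    is unique as [alpha0 Delta < 1]. *)

(** * Measurable selection of supergradients *)

(** The supergradient must depend on [w] in an [F_j]-measurable way, because its coordinates become
    coefficients of the transform [N]; hence a constructive selection instead of a separation
    argument for each [w]. These coefficients are unbounded in general: the bounds [alpha] are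
    random, and [1 - rho_j Delta_j], though positive, may come arbitrarily close to zero. So [N] is
    at first only a local martingale, and integrability has to be recovered from one-sided
    information: on the tested event [N_n <= Y_i - theta_i], whence [N_n^+ <= |Y_i| + theta_i^-].
    Each increment is localized on its own, by the events on which its coefficients are at most [m].
    The vanishing of a conditional expectation is expressed by integrals over the events of a
    sub-sigma-algebra ([centered]). The two halves of the contraction hypothesis do different work:
    [alpha0 Delta < 1] lets the implicit inequality be solved for [theta_j - Y_j] without reversing
    it, while the bound on [alpha |beta|] makes the right-hand side nondecreasing in
    [theta_{j+1} - Y_{j+1}]. *)

Section MeasurableSelection.
Context {d : measure_display} {T : measurableType d} {R : realType}.

Lemma measurable_comp_countable (K : countType) d' (U : measurableType d')
    (g : K -> T -> U) (kappa : T -> K) :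
  (forall c, measurable (kappa @^-1` [set c])) ->
  (forall c, measurable_fun setT (g c)) ->
  measurable_fun setT (fun w => g (kappa w) w).
Proof.
move=> mk mg _ B mB; rewrite setTI.
have -> : (fun w => g (kappa w) w) @^-1` B =
    \bigcup_c (kappa @^-1` [set c] `&` (setT `&` g c @^-1` B)).
  apply/seteqP; split => [w /= Bw|w [c _ [/= <- [_ //]]]].
  by exists (kappa w).
apply: countable_bigcupT_measurable => // c.
by apply: measurableI => //; exact: mg.
Qed.

Lemma measurable_floor_fiber (c : int) (X : T -> R) : measurable_fun setT X ->
  measurable [set w | Num.floor (X w) = c].
Proof.
move=> mX.
have -> : [set w | Num.floor (X w) = c] =
    setT `&` X @^-1` `[c%:~R, (c + 1)%:~R[%classic.
  apply/seteqP; split => w /=.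
    by move=> <-; split=> //; rewrite in_itv/= floor_itv.
  by case=> _; rewrite in_itv/= => h; apply: floor_def.
by apply: mX => //; exact: measurable_itv.
Qed.


Context {N : nat}.
Implicit Types (h : T -> ('I_N -> R) -> R) (A : 'I_N -> T -> R).

Definition lipschitz_field A h := forall w y y',
  `|h w y - h w y'| <= \sum_k A k w * `|y k - y' k|.

Lemma lipschitz_field_cvg A h w (u : nat -> 'I_N -> R) y : lipschitz_field A h ->
  (forall k, u ^~ k @ \oo --> y k) -> h w (u m) @[m --> \oo] --> h w y.
Proof.
move=> hl uy; apply/cvgrPdist_lt => e e0.
have cvg0 : \sum_k A k w * `|y k - u m k| @[m --> \oo] --> \sum_(k < N) A k w * 0.
  apply: cvg_big => [|k _]; first by move=> x; exact: add_continuous.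
  apply: cvgM; first exact: cvg_cst.
  rewrite -[X in _ --> X](@normr0 R R); apply: cvg_norm.
  rewrite -[X in _ --> X](subrr (y k)); apply: cvgB => //; exact: cvg_cst.
have : \sum_(k < N) A k w * 0 = 0 by rewrite big1// => k _; rewrite mulr0.
move=> s0; rewrite s0 in cvg0.
near=> m; apply: le_lt_trans (hl w _ _) _.
rewrite (le_lt_trans (ler_norm _))// -[X in `|X|]subr0 distrC.
by near: m; move/cvgrPdist_lt: cvg0; apply.
Unshelve. all: by end_near. Qed.

(** Rounding down to multiples of [1/(m+1)]: the values are countably many and rational, and both
    [x = 0] and [0 <= x] are preserved, as the density argument for supergradients requires. *)
Definition grid (m : nat) (x : R) : R := (Num.floor (m.+1%:R * x))%:~R / m.+1%:R.

Lemma grid_cvg (x : R) : grid m x @[m --> \oo] --> x.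
Proof.
apply/cvgrPdist_le => e e0; near=> m.
rewrite /grid; set c := Num.floor _.
have m0 : 0 < m.+1%:R :> R by [].
have /andP[c1 c2] := floor_itv (m.+1%:R * x); rewrite -/c in c1 c2.
have -> : x - c%:~R / m.+1%:R = (m.+1%:R * x - c%:~R) / m.+1%:R.
  by rewrite mulrBl mulrAC divff ?mul1r ?gt_eqF.
rewrite normrM ger0_norm ?subr_ge0// (ger0_norm (ltW _)) ?invr_gt0//.
apply: (@le_trans _ _ (m.+1%:R^-1)).
  rewrite ler_piMl ?invr_ge0 ?ler0n//; move: c2; rewrite intrD; lra.
by apply/ltW; near: m; exact: (near_infty_natSinv_lt (PosNum e0)).
Unshelve. all: by end_near. Qed.

(** A Caratheodory argument: measurability is known only for [h] at a fixed vector. On the grid the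
    argument takes countably many values, so the composition is glued from such sections; the
    Lipschitz bound passes to the limit. *)
Lemma measurable_lipschitz_comp A h (X : 'I_N -> T -> R) :
  lipschitz_field A h -> (forall y, measurable_fun setT (h^~ y)) ->
  (forall k, measurable_fun setT (X k)) ->
  measurable_fun setT (fun w => h w (fun k => X k w)).
Proof.
move=> hl mh mX.
apply: (@measurable_fun_cvg _ _ _ setT
   (fun m w => h w (fun k => grid m (X k w)))) => [m|w _]; last first.
  by apply: (@lipschitz_field_cvg A h w (fun m k => grid m (X k w))) => // k; exact: grid_cvg.
pose kappa w := [ffun k : 'I_N => Num.floor (m.+1%:R * X k w)].
pose g (c : {ffun 'I_N -> int}) w := h w (fun k => (c k)%:~R / m.+1%:R).
rewrite [X in measurable_fun _ X](_ : _ = fun w => g (kappa w) w); last first.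
  by apply/funext => w; congr h; apply/funext => k; rewrite ffunE.
apply: measurable_comp_countable => [c|c]; last exact: mh.
have -> : kappa @^-1` [set c] =
    \bigcap_(k in [set: 'I_N]) [set w | Num.floor (m.+1%:R * X k w) = c k].
  apply/seteqP; split => w /= H; first by move=> k _ /=; rewrite -H ffunE.
  by apply/ffunP => k; rewrite ffunE; apply: H.
apply: fin_bigcap_measurable => // k _; apply: measurable_floor_fiber.
exact: measurable_funM.
Qed.

End MeasurableSelection.

Section Supergradient.
Context {d : measure_display} {T : measurableType d} {R : realType}.

(** Countability of [K] makes the event that the supremum exceeds [a] a countable union;
    nonemptiness and the bound keep [sup] away from its default value. *)
Lemma measurable_sup_countable (K : countType) (C : set K) (r : K -> T -> R) :
  C !=set0 -> (forall w, has_ubound [set r c w | c in C]) ->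
  (forall c, measurable_fun setT (r c)) ->
  measurable_fun setT (fun w => sup [set r c w | c in C]).
Proof.
move=> [c0 Cc0] ub mr.
apply: (measurability _ (RGenOInfty.measurableE R)) => // _ [_ [a ->] <-].
rewrite setTI.
have -> : (fun w => sup [set r c w | c in C]) @^-1` `]a, +oo[%classic =
    \bigcup_c (if c \in C then setT `&` r c @^-1` `]a, +oo[%classic else set0).
  apply/seteqP; split => w /=.
    rewrite in_itv/= andbT => h.
    have [||_ [c Cc <-] ac] := @sup_adherent _ [set r c w | c in C]
      (sup [set r c w | c in C] - a); rewrite ?subr_gt0//.
      by split=> //; exists (r c0 w), c0.
    by exists c => //; rewrite (mem_set Cc)/=; split=> //; move: ac; rewrite in_itv/= andbT subKr.
  case=> c _; case: ifPn => // /set_mem Cc [_ /=]; rewrite !in_itv/= !andbT => h.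
  by apply: lt_le_trans h _; apply: ub_le_sup => //; exists c.
apply: countable_bigcupT_measurable => // c; case: ifP => // _.
exact: mr.
Qed.

Context {N : nat} (A : 'I_N -> T -> R) (h : T -> ('I_N -> R) -> R).
Hypothesis hlip : lipschitz_field A h.
Hypothesis hmeas : forall y, measurable_fun setT (h^~ y).
Hypothesis h0 : forall w, h w (fun=> 0) = 0.
Hypothesis hconc : forall w (lam : R) y y', 0 <= lam <= 1 ->
  lam * h w y + (1 - lam) * h w y' <= h w (fun k => lam * y k + (1 - lam) * y' k).

(** A finite-dimensional Hahn-Banach extension, one coordinate per induction step. Concavity keeps
    the quotients taken at positive values of the new coordinate below those taken at negative
    values, so the supremum of the former is an admissible slope. *)
Lemma partial_supergradient m : (m <= N)%N -> exists q : 'I_N -> T -> R,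
  (forall k, measurable_fun setT (q k)) /\
  forall w y, (forall k : 'I_N, (m <= k)%N -> y k = 0) -> h w y <= \sum_k q k w * y k.
Proof.
elim: m => [_|m IH mN].
  exists (fun _ _ => 0); split=> [k|w y y0]; first exact: measurable_cst.
  have -> : y = (fun=> 0) by apply/funext => k; exact: y0.
  by rewrite h0 big1// => k _; rewrite mulr0.
have [q [mq qP]] := IH (ltnW mN).
pose km := Ordinal mN.
pose lin w (y : 'I_N -> R) := \sum_(k | k != km) q k w * y k.
pose vec (c : {ffun 'I_N -> rat}) : 'I_N -> R := fun k => ratr (c k).
pose C := [set c : {ffun 'I_N -> rat} | 0 < c km /\ forall k : 'I_N, (m < k)%N -> c k = 0].
pose r c w := (h w (vec c) - lin w (vec c)) / vec c km.
have mlt (k : 'I_N) : (m <= k)%N -> k != km -> (m < k)%N.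
  by rewrite leq_eqVlt => /orP[/eqP e|//]; case/eqP; apply: val_inj.
have linE w y : y km = 0 -> \sum_k q k w * y k = lin w y.
  by move=> y0; rewrite (bigD1 km)//= y0 mulr0 add0r.
have hkm w y : (forall k : 'I_N, (m < k)%N -> y k = 0) -> y km = 0 -> h w y <= lin w y.
  move=> y0 ym; rewrite -linE//; apply: qP => k mk.
  by have [->//|kk] := eqVneq k km; apply: y0; exact: mlt.
have ub w : has_ubound [set r c w | c in C].
  exists (A km w) => _ [c [c0 cC] <-]; rewrite /r.
  have v0 : 0 < vec c km by rewrite /vec ltr0q.
  rewrite ler_pdivrMr// lerBlDl.
  (* Erasing coordinate [km] leads back to the subspace already treated; the Lipschitz bound in that
     single coordinate then bounds every quotient by [A km w]. *)
  pose y0 k := if k == km then 0 else vec c k.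
  have e1 : h w y0 <= lin w y0.
    apply: hkm => [k mk|]; rewrite /y0 ?eqxx//; case: ifP => // _.
    by rewrite /vec cC// rmorph0.
  have e2 : lin w y0 = lin w (vec c).
    by apply: eq_bigr => k /negbTE kk; rewrite /y0 kk.
  have := le_trans (ler_norm _) (hlip w (vec c) y0).
  rewrite (bigD1 km)//= big1 => [|k /negbTE kk]; last first.
    by rewrite /y0 kk subrr normr0 mulr0.
  rewrite {2}/y0 eqxx subr0 addr0 (gtr0_norm v0); lra.
have C0 : C !=set0.
  exists [ffun k => if k == km then 1 else 0]; split; first by rewrite ffunE eqxx.
  by move=> k mk; rewrite ffunE; case: eqP => // kk; rewrite kk ltnn in mk.
pose qm w := sup [set r c w | c in C].
have qmP w c : C c -> h w (vec c) <= lin w (vec c) + qm w * vec c km.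
  move=> Cc; have v0 : 0 < vec c km by rewrite /vec ltr0q; case: Cc.
  rewrite -lerBlDl -ler_pdivrMr//; apply: ub_le_sup => //.
  by exists c.
pose q' k w := if k == km then qm w else q k w.
have q'E w y : \sum_k q' k w * y k = lin w y + qm w * y km.
  rewrite (bigD1 km)//= {1}/q' eqxx addrC; congr +%R.
  by apply: eq_bigr => k /negbTE kk; rewrite /q' kk.
exists q'; split=> [k|w y y0].
  rewrite /q'; have [_|_] := eqVneq k km; last exact: mq.
  apply: measurable_sup_countable => // c.
  apply: measurable_funM => //; apply: measurable_funB; first exact: hmeas.
  rewrite /lin; under eq_fun do rewrite big_mkcond/=.
  apply: measurable_sum => k'; case: (k' != km) => //.
  exact: measurable_funM.
rewrite q'E; have [ym|ym] := leP 0 (y km).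
  (* For a nonnegative coordinate [km] the bound holds at rational points, by the choice of [qm] or,
     when the coordinate rounds to zero, by induction; continuity extends it to [y]. *)
  pose u (n : nat) : 'I_N -> R := fun k => grid n (y k).
  have uP n : 0 <= \sum_k q' k w * u n k - h w (u n).
    pose c := [ffun k : 'I_N => (Num.floor (n.+1%:R * y k))%:~R / n.+1%:R : rat].
    have cE : vec c = u n.
      apply/funext => k; rewrite /vec ffunE fmorph_div/= ratr_int.
      by rewrite ratr_nat.
    have c0 (k : 'I_N) : (m < k)%N -> c k = 0.
      by move=> mk; rewrite ffunE y0// mulr0 floor0 mul0r.
    have : 0 <= c km.
      by rewrite ffunE divr_ge0// ler0z floor_ge0 mulr_ge0.
    rewrite subr_ge0 q'E -cE le_eqVlt => /orP[/eqP ck|ck]; last exact: qmP.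
    have vk : vec c km = 0 by rewrite /vec -ck rmorph0.
    by rewrite vk mulr0 addr0; apply: hkm => // k mk; rewrite /vec c0// rmorph0.
  rewrite -q'E -subr_ge0.
  pose H w' (y' : 'I_N -> R) := \sum_k q' k w' * y' k - h w' y'.
  have Hl : lipschitz_field (fun k w' => `|q' k w'| + A k w') H.
    move=> w' a b; rewrite /H opprD opprK addrACA.
    rewrite -sumrB; apply: (le_trans (ler_normD _ _)).
    have -> : \sum_k (`|q' k w'| + A k w') * `|a k - b k| =
        \sum_k `|q' k w'| * `|a k - b k| + \sum_k A k w' * `|a k - b k|.
      by rewrite -big_split/=; apply: eq_bigr => k _; rewrite mulrDl.
    apply: lerD; last by rewrite addrC distrC; exact: hlip.
    apply: (le_trans (ler_norm_sum _ _ _)); apply: ler_sum => k _.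
    by rewrite -mulrBr normrM.
  have /(_ _) cv := lipschitz_field_cvg _ _ w u y Hl (fun k => grid_cvg (y k)).
  by apply: (cvgr_to_ge cv); apply: nearW => n; exact: uP.
(* For a negative coordinate the claim says that [qm] is at most the quotient at [y], so each
   [r c w] is compared with that quotient. *)
rewrite -lerBlDl -ler_ndivlMr//; apply: ge_sup.
  by case: C0 => c Cc; exists (r c w), c.
move=> _ [c Cc <-]; have v0 : 0 < vec c km by rewrite /vec ltr0q; case: Cc.
rewrite ler_ndivlMr// /r mulrAC ler_pdivlMr//.
set a := vec c km in v0 *; set b := y km in ym *.
have ab : 0 < a - b by rewrite subr_gt0 (lt_trans ym).
have ab0 : a - b != 0 by rewrite gt_eqF.
(* With this weight the convex combination of [y] and [vec c] has coordinate [km] equal to zero, so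
   the induction hypothesis bounds [h] there. *)
pose lam := a / (a - b).
have lam1 : 1 - lam = - b / (a - b) by rewrite /lam; field.
have lamI : 0 <= lam <= 1.
  apply/andP; split; first by rewrite divr_ge0// ltW.
  by rewrite -subr_ge0 lam1 divr_ge0 ?oppr_ge0 ?ltW.
have := hconc w lam y (vec c) lamI.
set z := (X in _ <= h w X) => hz.
have : h w z <= lin w z.
  apply: hkm => [k mk|]; rewrite /z /=; rewrite ?lam1.
    by rewrite y0// /vec (Cc.2 _ mk) rmorph0 !mulr0 addr0.
  rewrite /lam -/a -/b. by field.
have -> : lin w z = lam * lin w y + (1 - lam) * lin w (vec c).
  rewrite /lin !mulr_sumr -big_split/=; apply: eq_bigr => k _; rewrite /z.
  by ring.
move=> /(le_trans hz); rewrite lam1 /lam => H.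
have {}H : a * h w y - b * h w (vec c) <= a * lin w y - b * lin w (vec c).
  rewrite -(ler_pM2r (x := (a - b)^-1)) ?invr_gt0//.
  by apply: le_trans (le_trans H _); rewrite le_eqVlt; apply/orP; left; apply/eqP; field.
lra.
Qed.

(* Coordinate by coordinate, the [k]-th slope is the largest difference quotient
   in direction [k] that the slopes chosen so far allow; suprema over rational
   points suffice, which makes the selection measurable. *)
Lemma measurable_supergradient : exists q : 'I_N -> T -> R,
  [/\ forall k, measurable_fun setT (q k), forall k w, `|q k w| <= A k w &
      forall w y, h w y <= \sum_k q k w * y k].
Proof.
have [q [mq qP]] := partial_supergradient N (leqnn N).
have {}qP w y : h w y <= \sum_k q k w * y k.
  by apply: qP => k; rewrite leqNgt ltn_ord.
exists q; split=> // k w.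
(* Testing the linear majorant at plus and minus the [k]-th unit vector transfers the Lipschitz
   constant to the slope. *)
have H s : `|s| = 1 -> - A k w <= q k w * s.
  move=> s1; pose y (l : 'I_N) := if l == k then s else 0.
  have := hlip w y (fun=> 0); rewrite h0 subr0 (bigD1 k)//= big1 => [|l /negbTE lk]; last first.
    by rewrite /y lk subrr normr0 mulr0.
  rewrite /y eqxx subr0 s1 mulr1 addr0 ler_norml => /andP[hA _].
  apply: (le_trans hA); apply: (le_trans (qP _ _)).
  rewrite (bigD1 k)//= eqxx big1 ?addr0// => l /negbTE ->.
  by rewrite mulr0.
have := H 1 (normr1 _); have := H (-1) (normrN1 _).
rewrite ler_norml; lra.
Qed.

End Supergradient.

(** * Conditional expectations and centered variables *)

Section SubSigmaAlgebra.
Context {R : realType} {d : measure_display} {T : measurableType d}.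
Variable P : probability T R.
Variable G : set (set T).
Hypothesis salgG : sigma_algebra setT G.
Hypothesis subG : forall A, G A -> measurable A.

(** Regarding [X] as a map on [g_sigma_algebraType G] opens the closure rules for measurable
    functions to the sub-sigma-algebra [G]. *)
Lemma measurable_wrtP d' (U : measurableType d') (X : T -> U) :
  measurable_wrt G X <->
  measurable_fun (setT : set (g_sigma_algebraType G)) (X : g_sigma_algebraType G -> U).
Proof.
split=> [mX _ B mB|mX B mB].
  by rewrite setTI measurable_g_measurableTypeE//; exact: mX.
by have := mX measurableT B mB; rewrite setTI measurable_g_measurableTypeE.
Qed.

Lemma measurable_wrt_fun d' (U : measurableType d') (X : T -> U) :
  measurable_wrt G X -> measurable_fun setT X.
Proof. by move=> mX _ B mB; rewrite setTI; apply: subG; exact: mX. Qed.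

Lemma sub_measurableP (A : set T) : measurable (A : set (g_sigma_algebraType G)) <-> G A.
Proof. by rewrite measurable_g_measurableTypeE. Qed.

Lemma measurable_wrt_indic A : G A -> measurable_wrt G (\1_A : T -> R).
Proof.
by move=> GA; apply/measurable_wrtP; apply: measurable_indic; exact/sub_measurableP.
Qed.

Lemma measurable_wrtM (X Y : T -> R) : measurable_wrt G X -> measurable_wrt G Y ->
  measurable_wrt G (fun w => X w * Y w).
Proof.
move=> /measurable_wrtP mX /measurable_wrtP mY; apply/measurable_wrtP.
exact: measurable_funM.
Qed.

(** This is [E[X | G] = 0], expressed without choosing a version of the conditional expectation. *)
Definition centered (X : T -> R) : Prop :=
  integrable_rv P X /\ forall A, G A -> (\int[P]_(w in A) (X w)%:E = 0)%E.

Lemma integrable_rvD (X Y : T -> R) : integrable_rv P X -> integrable_rv P Y ->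
  integrable_rv P (fun w => X w + Y w).
Proof. by move=> iX iY; exact: (integrableD measurableT iX iY). Qed.

Lemma integrable_rvB (X Y : T -> R) : integrable_rv P X -> integrable_rv P Y ->
  integrable_rv P (fun w => X w - Y w).
Proof. by move=> iX iY; exact: (integrableB measurableT iX iY). Qed.

Lemma integrable_rv_measurable (X : T -> R) : integrable_rv P X -> measurable_fun setT X.
Proof. by move=> /measurable_int/measurable_EFinP. Qed.

Lemma integrable_rv_le (X Y : T -> R) : measurable_fun setT X ->
  (forall w, `|X w| <= `|Y w|) -> integrable_rv P Y -> integrable_rv P X.
Proof.
move=> mX XY; apply: le_integrable => //; first exact/measurable_EFinP.
by move=> w _; rewrite lee_fin XY.
Qed.

Lemma integrable_rv_boundedM (C : R) (H X : T -> R) : measurable_fun setT H ->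
  (forall w, `|H w| <= C) -> integrable_rv P X -> integrable_rv P (fun w => H w * X w).
Proof.
move=> mH HC iX; apply: (integrableMr measurableT mH _ iX).
exists C; split; first exact: num_real.
by move=> x Cx w _; exact: le_trans (HC w) (ltW Cx).
Qed.

Lemma integrable_rv_bounded (C : R) (H : T -> R) : measurable_fun setT H ->
  (forall w, `|H w| <= C) -> integrable_rv P H.
Proof.
move=> mH HC; have := integrable_rv_boundedM C H (cst 1) mH HC
  (finite_measure_integrable_cst _ _ measurableT).
by apply: eq_integrable => // w _; rewrite /= mulr1.
Qed.

Lemma integrable_rv_ae (X Y : T -> R) : measurable_fun setT Y ->
  {ae P, forall w, X w = Y w} -> integrable_rv P X -> integrable_rv P Y.
Proof.
move=> mY XY /integrableP[mX iX]; apply/integrableP; split; first exact/measurable_EFinP.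
rewrite (ae_eq_integral (fun w => `|(X w)%:E|)%E)//.
- by apply: measurableT_comp => //; exact/measurable_EFinP.
- exact: measurableT_comp.
- by apply: filterS XY => w /= ->.
Qed.

Lemma centeredD (X Y : T -> R) : centered X -> centered Y ->
  centered (fun w => X w + Y w).
Proof.
move=> [iX X0] [iY Y0]; split; first exact: integrable_rvD.
move=> A GA; have mA := subG _ GA.
have sub (Z : T -> R) : integrable_rv P Z -> P.-integrable A (EFin \o Z).
  by apply: integrableS.
under eq_integral do rewrite EFinD.
by rewrite integralD ?X0 ?Y0 ?adde0//; exact: sub.
Qed.

Lemma centeredN (X : T -> R) : centered X -> centered (fun w => - X w).
Proof.
move=> [iX X0]; split.
  exact: integrableN iX.
move=> A GA; have mA := subG _ GA.
under eq_integral => w _ do rewrite -mulN1r EFinM.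
rewrite integralZl// ?X0 ?mule0//; exact: integrableS iX.
Qed.

Lemma centeredB (X Y : T -> R) : centered X -> centered Y ->
  centered (fun w => X w - Y w).
Proof. by move=> cX /centeredN; exact: centeredD. Qed.

Lemma centered0 : centered (fun=> 0).
Proof.
split.
  by apply: (integrable_rv_bounded 0) => [|w]; [exact: measurable_cst|rewrite normr0].
by move=> A _; rewrite integral0.
Qed.

Lemma centered_sum (I : Type) (s : seq I) (X : I -> T -> R) :
  (forall k, centered (X k)) -> centered (fun w => \sum_(k <- s) X k w).
Proof.
move=> cX; elim: s => [|k s IH].
  by under eq_fun do rewrite big_nil; exact: centered0.
by under eq_fun do rewrite big_cons; exact: centeredD.
Qed.

Lemma centered_ae (X Y : T -> R) : measurable_fun setT Y ->
  {ae P, forall w, X w = Y w} -> centered X -> centered Y.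
Proof.
move=> mY XY [iX X0]; split; first exact: integrable_rv_ae XY iX.
move=> A GA; have mA := subG _ GA; rewrite -(X0 A GA).
apply: ae_eq_integral => //.
- exact/measurable_EFinP/measurable_funTS.
- exact/measurable_EFinP/measurable_funTS/integrable_rv_measurable.
- by apply: filterS XY => w /= ->.
Qed.

Lemma positive_integral_le0_null (A : set T) (W : T -> \bar R) : measurable A ->
  P.-integrable A W -> (\int[P]_(w in A) W w <= 0)%E ->
  (forall w, A w -> (0 < W w)%E) -> P A = 0%E.
Proof.
move=> mA iW W0 Wpos.
have : (\int[P]_(w in A) `|W w| = 0)%E.
  apply/eqP; rewrite eq_le integral_ge0// andbT.
  by under eq_integral => w /set_mem Aw do rewrite gee0_abs ?ltW ?Wpos//.
have mW : measurable_fun A W by apply: measurable_int iW.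
move=> /(ae_eq_integral_abs P mA mW) [N [mN N0 sN]].
apply: (subset_measure0 mA mN _ N0) => w Aw; apply: sN => /= /(_ Aw) Ww0.
by have := Wpos w Aw; rewrite Ww0 ltxx.
Qed.

(** Uniqueness of conditional expectations in disguise: the events where [X] is positive or negative
    belong to [G], and testing on them forces them to be null. *)
Lemma centered_measurable_eq0 (X : T -> R) : measurable_wrt G X -> centered X ->
  {ae P, forall w, X w = 0}.
Proof.
have H (Z : T -> R) : measurable_wrt G Z -> centered Z -> {ae P, forall w, Z w <= 0}.
  move=> mZ [iZ Z0]; pose A := Z @^-1` `]0, +oo[%classic.
  have GA : G A by apply: mZ; exact: measurable_itv.
  exists A; split; first exact: subG.
    apply: (positive_integral_le0_null A (EFin \o Z)).
    - exact: subG.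
    - by apply: integrableS iZ => //; exact: subG.
    - by rewrite Z0.
    - by move=> w; rewrite /A/= in_itv/= andbT lte_fin.
  by move=> w /= /negP; rewrite -ltNge /A/= in_itv/= andbT.
move=> mX cX; have hX := H X mX cX.
have hN : {ae P, forall w, - X w <= 0}.
  apply: H; last exact: centeredN.
  by apply/measurable_wrtP; apply: measurableT_comp => //; exact/measurable_wrtP.
apply: filterS2 hX hN => w; rewrite oppr_le0 => h1 h2.
by apply/eqP; rewrite eq_le h1.
Qed.

Lemma integral_rv_indic (A : set T) (f : T -> R) :
  (\int[P]_(w in A) (f w)%:E = \int[P]_w (\1_A w * f w)%:E)%E.
Proof.
rewrite integral_mkcond; apply: eq_integral => w _; rewrite patchE indicE.
by case: (_ \in _); rewrite ?mul1r ?mul0r.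
Qed.

(** The simple approximations of [H] are built on [g_sigma_algebraType G], so their level sets lie
    in [G] and [X] integrates to zero over each; dominated convergence with bound [|C * X|] reaches
    [H]. *)
Lemma centered_bounded_ge0_mul (C : R) (H X : T -> R) : measurable_wrt G H ->
  (forall w, 0 <= H w <= C) -> centered X -> (\int[P]_w (H w * X w)%:E = 0)%E.
Proof.
move=> mH HC [iX X0]; pose TG := g_sigma_algebraType G.
have mHG : measurable_fun (setT : set TG) (EFin \o H).
  by apply/measurable_EFinP; exact/measurable_wrtP.
pose phi := nnsfun_approx measurableT mHG.
have H0 (w : TG) : setT w -> (0 <= (EFin \o H) w)%E.
  by move=> _; rewrite lee_fin; have /andP[] := HC w.
have phi_cvg w : phi k w @[k --> \oo] --> H w.
  by have /fine_cvgP[_] := cvg_nnsfun_approx measurableT mHG H0 (x := w) I.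
have phi_le k w : phi k w <= H w.
  apply: (cvgr_to_ge (phi_cvg w)).
  exists k => // m /= km.
  by have /lefP/(_ w) := nd_nnsfun_approx measurableT mHG km.
have phi0 k w : 0 <= phi k w by exact: fun_ge0.
have mphi k : measurable_fun (setT : set T) (phi k : T -> R).
  by apply: measurable_wrt_fun; apply/measurable_wrtP; exact: measurable_funPT.
have phi_int k : (\int[P]_w (phi k w * X w)%:E = 0)%E.
  pose s : seq R := finmap.enum_fset (fset_set (phi k @` setT)).
  have GA y : G (phi k @^-1` [set y]).
    by apply/sub_measurableP; exact: measurable_funPTI.
  have iZ (j : nat) : integrable_rv P (fun w => s`_j * (\1_(phi k @^-1` [set s`_j]) w * X w)).
    apply: (integrable_rv_boundedM `|s`_j|) => //.
    apply: (integrable_rv_boundedM 1) => // [|w].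
      by apply: measurable_indic; apply: subG; exact: GA.
    by rewrite indicE; case: (_ \in _); rewrite ?normr1 ?normr0.
  rewrite (eq_integral (fun w : T => \sum_(j < size s)
      (s`_j * (\1_(phi k @^-1` [set s`_j]) w * X w))%:E)%E); last first.
    move=> w _; rewrite sumEFin fimfunEord mulr_suml; congr EFin.
    by apply: eq_bigr => j _; rewrite mulrA.
  rewrite integral_sum//= => [|j]; last exact: iZ.
  apply: big1 => j _.
  have mA : measurable (phi k @^-1` [set s`_j] : set T) by apply: subG; exact: GA.
  under eq_integral do rewrite EFinM.
  rewrite integralZl//; last first.
    apply: (integrable_rv_boundedM 1) => // w.
    by rewrite indicE; case: (_ \in _); rewrite ?normr1 ?normr0.
  have <- := integral_rv_indic (phi k @^-1` [set s`_j]) X.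
  by rewrite X0 ?mule0//; exact: GA.
have iC : P.-integrable setT (fun w => `|(C * X w)%:E|)%E.
  by apply: integrable_abse; apply: (integrable_rv_boundedM `|C|).
have [||||_ _] := @dominated_convergence _ _ _ P setT measurableT
  (fun k w => (phi k w * X w)%:E) (fun w => (H w * X w)%:E)
  (fun w => `|(C * X w)%:E|)%E _ _ _ iC.
- by move=> k; apply/measurable_EFinP/measurable_funM => //; exact: integrable_rv_measurable.
- apply/measurable_EFinP/measurable_funM; first exact: measurable_wrt_fun.
  exact: integrable_rv_measurable.
- apply: aeW => w _; apply: cvg_EFin; first exact: nearW.
  by apply: cvgM; [exact: phi_cvg|exact: cvg_cst].
- apply: aeW => w k _; rewrite !abse_EFin lee_fin !normrM ler_wpM2r//.
  have /andP[_ HwC] := HC w.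
  by rewrite !ger0_norm ?(le_trans (phi_le _ _))// (le_trans _ HwC)// (le_trans _ (phi_le k w)).
move=> cv; apply: (cvg_unique _ cv) => //.
by apply: cvg_near_cst; exact: nearW.
Qed.

Lemma centered_bounded_mul (C : R) (H X : T -> R) : measurable_wrt G H ->
  (forall w, `|H w| <= C) -> centered X -> centered (fun w => H w * X w).
Proof.
move=> mH HC cX; split.
  apply: (integrable_rv_boundedM C) => //; last exact: cX.1.
  exact: measurable_wrt_fun.
move=> A GA; have mA := subG _ GA.
(* Writing [H] as [(H + C) - C] reduces to two nonnegative bounded multipliers; the indicator of the
   test event [A] is absorbed into both. *)
pose H1 w := \1_A w * (H w + C); pose H2 w := \1_A w * C : R.
have C0 (w : T) : 0 <= C by rewrite (le_trans _ (HC w)).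
have mH1 : measurable_wrt G H1.
  apply: measurable_wrtM; first exact: measurable_wrt_indic.
  apply/measurable_wrtP; apply: measurable_funD; first exact/measurable_wrtP.
  exact: measurable_cst.
have mH2 : measurable_wrt G H2.
  apply: measurable_wrtM; first exact: measurable_wrt_indic.
  by apply/measurable_wrtP; exact: measurable_cst.
have H1B w : 0 <= H1 w <= C + C.
  rewrite /H1 indicE; have := HC w; rewrite ler_norml => /andP[h1 h2].
  move: (C0 w) => {}C0.
  by case: (_ \in _); rewrite ?mul1r ?mul0r; apply/andP; split; lra.
have H2B w : 0 <= H2 w <= C.
  by have := C0 w; rewrite /H2 indicE; case: (_ \in _); rewrite ?mul1r ?mul0r lexx => ->.
have e1 := centered_bounded_ge0_mul _ _ _ mH1 H1B cX.
have e2 := centered_bounded_ge0_mul _ _ _ mH2 H2B cX.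
have i1 : integrable_rv P (fun w => H1 w * X w).
  apply: (integrable_rv_boundedM (C + C)); last exact: cX.1.
    exact: measurable_wrt_fun.
  by move=> w; have /andP[? ?] := H1B w; rewrite ger0_norm.
have i2 : integrable_rv P (fun w => H2 w * X w).
  apply: (integrable_rv_boundedM C); last exact: cX.1.
    exact: measurable_wrt_fun.
  by move=> w; have /andP[? ?] := H2B w; rewrite ger0_norm.
rewrite integral_mkcond.
rewrite (eq_integral (fun w => (H1 w * X w)%:E - (H2 w * X w)%:E)%E); last first.
  move=> w _; rewrite patchE /H1 /H2 indicE -EFinB -mulrBl -mulrBr addrK.
  by case: (_ \in _); rewrite ?mul1r ?mul0r.
by rewrite integralB// e1 e2 sube0.
Qed.

(** * Local martingale increments and the removal of localization *)

Lemma integrable_rv_limit (f : T -> R) (B : nat -> set T) (c : R) :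
  measurable_fun setT f -> (forall w, 0 <= f w) ->
  (forall m, measurable (B m)) -> nondecreasing_seq B -> \bigcup_m B m = setT ->
  (forall m, (\int[P]_(w in B m) (f w)%:E <= c%:E)%E) -> integrable_rv P f.
Proof.
move=> mf f0 mB ndB UB Bc; apply/integrableP; split; first exact/measurable_EFinP.
have mfE : measurable_fun setT (EFin \o f) by exact/measurable_EFinP.
apply: (@le_lt_trans _ _ c%:E); last exact: ltry.
under eq_integral do rewrite gee0_abs ?lee_fin//.
have cv := @ge0_nondecreasing_set_cvg_integral _ T R B (EFin \o f) P ndB mB
  (fun m => measurable_funTS mfE) (fun m w _ => f0 w).
rewrite UB in cv; rewrite -(cvg_lim _ cv)//.
by apply: lime_le; [apply/cvg_ex; eexists; exact: cv|exact: nearW].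
Qed.

(** The centered term integrates to zero, so the integral of [f] over [B m] is at most that of [g],
    uniformly in [m], and monotone convergence removes [B m]. The compensator may depend on [m]
    because it is usually centered only after localization. *)
Lemma integrable_rv_compensated (f g : T -> R) (B : nat -> set T) (h : nat -> T -> R) :
  measurable_fun setT f -> (forall w, 0 <= f w) -> integrable_rv P g ->
  (forall m, measurable (B m)) -> nondecreasing_seq B -> \bigcup_m B m = setT ->
  (forall m, centered (h m)) -> (forall m, integrable_rv P (fun w => \1_(B m) w * f w)) ->
  (forall m w, \1_(B m) w * f w + h m w <= g w) -> integrable_rv P f.
Proof.
move=> mf f0 ig mB ndB UB ch iBf fg.
have GT : G setT by case: salgG => G0 GC _; rewrite -(setD0 setT); exact: GC.
have /fineK gE : (\int[P]_w (g w)%:E)%E \is a fin_num by exact: integrable_fin_num.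
apply: (integrable_rv_limit f B (fine (\int[P]_w (g w)%:E)%E)) => // m.
rewrite gE integral_rv_indic.
have [ih h0] := ch m.
have -> : (\int[P]_w (\1_(B m) w * f w)%:E =
    \int[P]_w (\1_(B m) w * f w + h m w)%:E)%E.
  have := integralD measurableT (iBf m) ih; rewrite [X in (_ + X)%E]h0// adde0 => <-.
  by apply: eq_integral => w _; rewrite EFinD.
apply: le_integral => //; first exact: integrable_rvD.
by move=> w _; rewrite lee_fin fg.
Qed.

(* Increments of a local martingale: the localizing sets depend on the step. *)
Definition locally_centered (X : T -> R) : Prop :=
  exists B : nat -> set T, [/\ forall m, G (B m), nondecreasing_seq B,
    \bigcup_m B m = setT & forall m, centered (fun w => \1_(B m) w * X w)].

Definition sublevel (S : T -> R) (m : nat) := [set w | S w <= m%:R].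

Lemma sublevel_sets (S : T -> R) : measurable_wrt G S -> (forall w, 0 <= S w) ->
  [/\ forall m, G (sublevel S m), nondecreasing_seq (sublevel S) &
      \bigcup_m sublevel S m = setT].
Proof.
move=> mS S0; split=> [m|m1 m2 m12|].
- have -> : sublevel S m = S @^-1` `]-oo, m%:R]%classic.
    by apply/seteqP; split => w /=; rewrite in_itv.
  by apply: mS; exact: measurable_itv.
- apply/subsetPset => w; rewrite /sublevel /= => /le_trans; apply.
  by rewrite ler_nat.
- apply/seteqP; split => // w _; exists (Num.bound (S w)) => //.
  by rewrite /sublevel /= ltW// archi_boundP.
Qed.

(** Cutting at the event where the sum of the [|H k|] is at most [m] leaves bounded [G]-measurable
    coefficients. *)
Lemma transform_locally_centered K (H X : 'I_K -> T -> R) :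
  (forall k, measurable_wrt G (H k)) -> (forall k, centered (X k)) ->
  locally_centered (fun w => \sum_k H k w * X k w).
Proof.
move=> mH cX; pose S w := \sum_k `|H k w|.
have mS : measurable_wrt G S.
  apply/measurable_wrtP; apply: measurable_sum => k.
  by apply: measurableT_comp => //; exact/measurable_wrtP.
have S0 w : 0 <= S w by exact: sumr_ge0.
have [GB ndB UB] := sublevel_sets S mS S0.
exists (sublevel S); split => // m.
under eq_fun do rewrite mulr_sumr; apply: centered_sum => k.
have := centered_bounded_mul m%:R
  (fun w => \1_(sublevel S m) w * H k w) (X k) _ _ (cX k).
under [X in _ -> _ -> centered X]eq_fun do rewrite -mulrA; apply.
  by apply: measurable_wrtM => //; exact: measurable_wrt_indic.
move=> w; rewrite indicE; have [/set_mem/= Sm|_] := boolP (_ \in _); last first.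
  by rewrite mul0r normr0.
rewrite mul1r; apply: le_trans Sm; rewrite /S (bigD1 k)//= lerDl.
exact: sumr_ge0.
Qed.

Lemma locally_centered_integrable (X : T -> R) : locally_centered X ->
  integrable_rv P X -> centered X.
Proof.
move=> [B [GB ndB UB cB]] iX; split => // A GA.
have mA := subG _ GA.
have mX := integrable_rv_measurable _ iX.
have iXA : P.-integrable A (fun w => `|(X w)%:E|)%E.
  by apply: integrable_abse => //; exact: integrableS iX.
have [||||_ _] := @dominated_convergence _ _ _ P A mA
  (fun m w => (\1_(B m) w * X w)%:E) (fun w => (X w)%:E) (fun w => `|(X w)%:E|)%E _ _ _ iXA.
- move=> m; apply/measurable_EFinP/measurable_funTS/measurable_funM => //.
  by apply: measurable_indic; exact: subG.
- exact/measurable_EFinP/measurable_funTS.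
- apply: aeW => w _.
  have : (\bigcup_m B m) w by rewrite UB.
  move=> [m _ Bm]; apply: cvg_near_cst; exists m => // k /= mk.
  have Bk : B k w by have /subsetPset := ndB _ _ mk; apply.
  by rewrite indicE mem_set// mul1r.
- apply: aeW => w m _; rewrite !abse_EFin lee_fin indicE.
  by case: (_ \in _); rewrite ?mul1r ?mul0r ?normr0.
move=> cv; apply: (cvg_unique _ cv) => //.
have c0 m : (\int[P]_(w in A) (\1_(B m) w * X w)%:E = 0)%E := (cB m).2 A GA.
by apply: cvg_near_cst; exact: nearW.
Qed.

(** A localized Jensen inequality: where [U > 0], adding the increment [V - U] to the positive part
    of [U] gives [V], which is at most its positive part. Elsewhere the positive part of [U]
    vanishes. *)
Lemma locally_centered_pos_integrable (U V : T -> R) :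
  measurable_wrt G U -> locally_centered (fun w => V w - U w) ->
  integrable_rv P (fun w => Num.max (V w) 0) -> integrable_rv P (fun w => Num.max (U w) 0).
Proof.
move=> mU [B [GB ndB UB cB]] iV.
have mU' : measurable_fun setT U by exact: measurable_wrt_fun.
have mN : measurable_wrt G (fun w => `|U w|).
  by apply/measurable_wrtP; apply: measurableT_comp => //; exact/measurable_wrtP.
have [GC ndC UC] := sublevel_sets _ mN (fun w => normr_ge0 (U w)).
set C := sublevel _ in GC ndC UC.
(* [B m] makes the increment centered, and [C m] bounds [U] so that its positive part is integrable
   there. *)
pose D m := B m `&` C m.
have GI A1 A2 : G A1 -> G A2 -> G (A1 `&` A2).
  by move=> /sub_measurableP m1 /sub_measurableP m2; apply/sub_measurableP/measurableI.
pose U0 := [set w | 0 < U w].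
have GU0 : G U0.
  have -> : U0 = U @^-1` `]0, +oo[%classic.
    by apply/seteqP; split => w /=; rewrite in_itv/= andbT.
  by apply: mU; exact: measurable_itv.
have GD m : G (D m) by exact: GI.
apply: (integrable_rv_compensated (fun w => Num.max (U w) 0) (fun w => Num.max (V w) 0) D
   (fun m w => \1_(D m `&` U0) w * (\1_(B m) w * (V w - U w)))) => //.
- by apply: measurable_maxr => //; exact: measurable_cst.
- by move=> w; rewrite le_max lexx orbT.
- by move=> m; exact: subG.
- move=> m1 m2 m12; apply/subsetPset; apply: setISS; apply/subsetPset; [exact: ndB|exact: ndC].
- apply/seteqP; split => // w _.
  have : (\bigcup_m B m) w by rewrite UB.
  have : (\bigcup_m C m) w by rewrite UC.
  move=> [m1 _ C1] [m2 _ B2]; exists (maxn m1 m2) => //; split.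
    by have /subsetPset := ndB _ _ (leq_maxr m1 m2); apply.
  by have /subsetPset := ndC _ _ (leq_maxl m1 m2); apply.
- move=> m; apply: (centered_bounded_mul 1) => //.
    by apply: measurable_wrt_indic; exact: GI.
  by move=> w; rewrite indicE; case: (_ \in _); rewrite ?normr1 ?normr0.
- move=> m; apply: (integrable_rv_bounded m%:R).
    apply: measurable_funM; first by apply: measurable_indic; exact: subG.
    by apply: measurable_maxr => //; exact: measurable_cst.
  move=> w; rewrite indicE; have [/set_mem[_ /= Cm]|_] := boolP (_ \in _); last first.
    by rewrite mul0r normr0.
  by rewrite mul1r /Num.max; case: ifP => _; rewrite ?normr0.
- move=> m w; rewrite !indicE !in_setI.
  have [/set_mem Bm|_] := boolP (w \in B m); last first.
    by rewrite !mul0r addr0 le_max lexx orbT.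
  have [/set_mem Cm|_] := boolP (w \in C m); last first.
    by rewrite !mul0r addr0 le_max lexx orbT.
  have [/set_mem/= U0w|/negP] := boolP (w \in U0) => /=.
    by rewrite !mul1r (max_idPl (ltW U0w)) addrC subrK le_max lexx.
  move=> /(contra_not (@mem_set _ _ _)) /= /negP; rewrite -leNgt => Uw.
  by rewrite (max_idPr Uw) mulr0 mul0r addr0 le_max lexx orbT.
Qed.

(** Only the negative part of [V] is missing. Adding the increment [V - U] to it gives the positive
    part of [V] minus [U], which is bounded by an integrable variable. *)
Lemma locally_centered_step (U V : T -> R) :
  integrable_rv P U -> measurable_fun setT V -> locally_centered (fun w => V w - U w) ->
  integrable_rv P (fun w => Num.max (V w) 0) ->
  integrable_rv P V /\ centered (fun w => V w - U w).
Proof.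
move=> iU mV lVU iV; suff iV' : integrable_rv P V.
  by split => //; apply: locally_centered_integrable => //; exact: integrable_rvB.
have [B [GB ndB UB cB]] := lVU.
have mB m : measurable (B m) by exact: subG.
have iN : integrable_rv P (fun w => Num.max (- V w) 0).
  apply: (integrable_rv_compensated _ (fun w => Num.max (V w) 0 + `|U w|) B
     (fun m w => \1_(B m) w * (V w - U w))) => //.
  - by apply: measurable_maxr; [exact: measurable_funN|exact: measurable_cst].
  - by move=> w; rewrite le_max lexx orbT.
  - by apply: integrable_rvD => //; exact: (integrable_norm iU).
  - move=> m; apply: (integrable_rv_le _
      (fun w => \1_(B m) w * U w + \1_(B m) w * (V w - U w))).
    + apply: measurable_funM; first exact: measurable_indic.
      by apply: measurable_maxr; [exact: measurable_funN|exact: measurable_cst].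
    + move=> w; rewrite -mulrDr addrC subrK !normrM ler_wpM2l//.
      rewrite /Num.max; case: ifP => _; first by rewrite normr0.
      by rewrite normrN.
    + apply: integrable_rvD; last exact: (cB m).1.
      apply: (integrable_rv_boundedM 1) => // w.
      by rewrite indicE; case: (_ \in _); rewrite ?normr1 ?normr0.
  - move=> m w; rewrite indicE; have Un := ler_norm (U w); have Un' := ler_norm (- U w).
    rewrite normrN in Un'; have U0 := normr_ge0 (U w).
    case: (_ \in _); rewrite ?mul1r ?mul0r; last first.
      by rewrite addr0 addr_ge0// le_max lexx orbT.
    by rewrite /Num.max; case: ifPn; case: ifPn; rewrite -?leNgt; lra.
have := integrable_rvB _ _ iV iN; congr integrable_rv; apply/funext => w.
rewrite /Num.max; case: ifPn; case: ifPn; rewrite -?leNgt; lra.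
Qed.

(** * Conditional expectation given one sub-sigma-algebra *)

Section ConditionalExpectation.
Variables (CE : nat -> (T -> \bar R) -> T -> \bar R) (i : nat).
Local Notation E := (CE i).
Hypothesis condexpE : forall X, measurable_fun setT X -> (forall w, 0 <= X w)%E ->
  [/\ measurable_wrt G (E X), (forall w, 0 <= E X w)%E &
      forall A, G A -> (\int[P]_(w in A) E X w = \int[P]_(w in A) X w)%E].

Lemma condE_measurable (X : T -> \bar R) : measurable_fun setT X ->
  measurable_wrt G (condE CE i X).
Proof.
move=> mX; have [m1 _ _] := condexpE _ (measurable_funepos mX) (funepos_ge0 X).
have [m2 _ _] := condexpE _ (measurable_funeneg mX) (funeneg_ge0 X).
move/measurable_wrtP : m1 => m1; move/measurable_wrtP : m2 => m2.
by apply/measurable_wrtP; exact: emeasurable_funB.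
Qed.

Lemma condER_measurable (X : T -> R) : measurable_fun setT X ->
  measurable_wrt G (condER CE i X).
Proof.
move=> mX; apply/measurable_wrtP.
apply: measurableT_comp => //; apply/measurable_wrtP/condE_measurable.
exact/measurable_EFinP.
Qed.

Lemma integrable_condexp (X : T -> \bar R) : (forall w, 0 <= X w)%E ->
  P.-integrable setT X -> P.-integrable setT (E X).
Proof.
move=> X0 /integrableP[mX iX]; have [mE E0 EA] := condexpE _ mX X0.
have GT : G setT by case: salgG => G0 GC _; rewrite -(setD0 setT); exact: GC.
apply/integrableP; split; first exact: measurable_wrt_fun.
under eq_integral do rewrite gee0_abs//.
by rewrite EA//; move: iX; under eq_integral do rewrite gee0_abs//.
Qed.

(** The conditional expectations of both parts of [X] are integrable, hence finite almost
    everywhere, so [fine] loses nothing there. *)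
Lemma condE_ae (X : T -> R) : integrable_rv P X ->
  {ae P, forall w, condE CE i (EFin \o X) w = (condER CE i X w)%:E}.
Proof.
move=> iX.
have /(integrable_ae measurableT) h1 :=
  integrable_condexp _ (funepos_ge0 _) (integrable_funepos measurableT iX).
have /(integrable_ae measurableT) h2 :=
  integrable_condexp _ (funeneg_ge0 _) (integrable_funeneg measurableT iX).
apply: filterS2 h1 h2 => w /(_ I) f1 /(_ I) f2.
by rewrite /condER fineK// /condE fin_numB f1.
Qed.

Lemma condER_integrable (X : T -> R) : integrable_rv P X ->
  integrable_rv P (condER CE i X).
Proof.
move=> iX; have mX := integrable_rv_measurable _ iX.
have i1 := integrable_condexp _ (funepos_ge0 _) (integrable_funepos measurableT iX).
have i2 := integrable_condexp _ (funeneg_ge0 _) (integrable_funeneg measurableT iX).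
have /integrableP[mD iD] := integrableB measurableT i1 i2.
apply/integrableP; split.
  apply/measurable_EFinP; apply: measurable_wrt_fun; exact: condER_measurable.
rewrite (ae_eq_integral (fun w => `|condE CE i (EFin \o X) w|)%E)//.
- apply: measurableT_comp => //; apply/measurable_EFinP; apply: measurable_wrt_fun.
  exact: condER_measurable.
- by apply: measurableT_comp => //; exact: mD.
- by apply: filterS (condE_ae _ iX) => w /= ->.
Qed.

Lemma condER_centered (X : T -> R) : integrable_rv P X ->
  centered (fun w => X w - condER CE i X w).
Proof.
move=> iX; have mX := integrable_rv_measurable _ iX.
have iE := condER_integrable _ iX.
have ip := integrable_funepos measurableT iX.
have im := integrable_funeneg measurableT iX.
have i1 := integrable_condexp _ (funepos_ge0 _) ip.
have i2 := integrable_condexp _ (funeneg_ge0 _) im.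
split; first exact: integrable_rvB.
move=> A GA; have mA := subG _ GA.
have sub (Z : T -> \bar R) : P.-integrable setT Z -> P.-integrable A Z.
  exact: integrableS.
under eq_integral do rewrite EFinB.
rewrite integralB//; [|exact: sub|exact: sub].
rewrite [X in (_ - X)%E](_ : _ = (\int[P]_(w in A) condE CE i (EFin \o X) w)%E); last first.
  apply: ae_eq_integral => //.
  - by apply: measurable_int; exact: sub iE.
  - by apply: measurable_int; apply: sub; exact: integrableB.
  - by apply: filterS (condE_ae _ iX) => w /= ->.
rewrite /condE integralB//; [|exact: sub|exact: sub].
have [_ _ ->//] := condexpE _ (measurable_int _ ip) (funepos_ge0 _).
have [_ _ ->//] := condexpE _ (measurable_int _ im) (funeneg_ge0 _).
rewrite -integralB//; [|exact: sub|exact: sub].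
rewrite [X in (_ - X)%E](_ : _ = (\int[P]_(w in A) (X w)%:E)%E).
  by rewrite subee//; apply: integrable_fin_num => //; exact: sub.
apply: eq_integral => w _.
exact: (esym (congr1 (@^~ w) (funeposneg (EFin \o X)))).
Qed.

(** The weighted inequality [E[a |E[X|G]|] <= E[a |X|]] for an unbounded weight: with [s] the sign
    of [V], adding [a s (X - V)] to [a |V|] gives [a s X <= a |X|], and the added term is centered
    on the events where [a <= m]. *)
Lemma integrable_mul_condER (a X : T -> R) : measurable_wrt G a -> (forall w, 0 <= a w) ->
  integrable_rv P X -> integrable_rv P (fun w => a w * `|X w|) ->
  integrable_rv P (fun w => a w * `|condER CE i X w|).
Proof.
move=> ma a0 iX iaX; set V := condER CE i X.
have mV : measurable_wrt G V by apply: condER_measurable; exact: integrable_rv_measurable.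
have [GB ndB UB] := sublevel_sets a ma a0; set B := sublevel a in GB ndB UB.
pose V0 := [set w | 0 <= V w].
have GV0 : G V0.
  have -> : V0 = V @^-1` `[0, +oo[%classic.
    by apply/seteqP; split => w /=; rewrite in_itv/= andbT.
  by apply: mV; exact: measurable_itv.
pose s w : R := 2 * \1_V0 w - 1.
have sV w : s w * V w = `|V w|.
  rewrite /s indicE; have [/set_mem/= Vw|/negP] := boolP (w \in V0).
    by rewrite (ger0_norm Vw) mulr1; lra.
  move=> /(contra_not (@mem_set _ _ _)) /= /negP; rewrite -ltNge => Vw.
  by rewrite (ltr0_norm Vw) mulr0; lra.
have s1 w : `|s w| = 1.
  rewrite /s indicE; case: (_ \in _); rewrite ?mulr1 ?mulr0 ?sub0r ?normrN1//.
  by rewrite (_ : 2 - 1 = 1) ?normr1//; lra.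
have ms : measurable_wrt G s.
  apply/measurable_wrtP; apply: measurable_funB; last exact: measurable_cst.
  by apply: measurable_funM; [exact: measurable_cst|exact/measurable_wrtP/measurable_wrt_indic].
have mBa m : measurable_wrt G (fun w => \1_(B m) w * a w).
  by apply: measurable_wrtM => //; exact: measurable_wrt_indic.
have Ba m w : `|\1_(B m) w * a w| <= m%:R.
  rewrite indicE; have [/set_mem/= Bw|_] := boolP (w \in B m); last by rewrite mul0r normr0.
  by rewrite mul1r ger0_norm.
have iV := condER_integrable _ iX.
apply: (integrable_rv_compensated _ (fun w => a w * `|X w|) B
   (fun m w => (\1_(B m) w * a w * s w) * (X w - V w))) => //.
- apply: measurable_funM; first exact: measurable_wrt_fun.
  by apply: measurableT_comp => //; exact: measurable_wrt_fun.
- by move=> w; rewrite mulr_ge0.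
- by move=> m; exact: subG.
- move=> m; apply: (centered_bounded_mul m%:R).
  + exact: measurable_wrtM.
  + by move=> w; rewrite normrM s1 mulr1.
  + exact: condER_centered.
- move=> m; under eq_fun do rewrite mulrA.
  apply: (integrable_rv_boundedM m%:R) => //; first exact: measurable_wrt_fun.
  exact: (integrable_norm iV).
- move=> m w; rewrite -sV.
  have -> : \1_(B m) w * (a w * (s w * V w)) + \1_(B m) w * a w * s w * (X w - V w) =
     \1_(B m) w * (a w * (s w * X w)) by ring.
  have sX : s w * X w <= `|X w| by rewrite (le_trans (ler_norm _))// normrM s1 mul1r.
  rewrite indicE; case: (_ \in _); rewrite ?mul1r ?mul0r ?mulr_ge0//.
  by rewrite ler_wpM2l.
Qed.

Lemma condER_unique (X V : T -> R) : integrable_rv P X -> measurable_wrt G V ->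
  centered (fun w => X w - V w) -> {ae P, forall w, condER CE i X w = V w}.
Proof.
move=> iX mV cV; have cE := condER_centered _ iX.
have mE : measurable_wrt G (condER CE i X).
  by apply: condER_measurable; exact: integrable_rv_measurable.
have := centered_measurable_eq0 (fun w => condER CE i X w - V w).
move=> H; apply: filterS (H _ _) => [w /eqP||]; first by rewrite subr_eq0 => /eqP.
  move/measurable_wrtP : mE => mE; move/measurable_wrtP : mV => mV.
  by apply/measurable_wrtP; exact: measurable_funB.
have := centeredB _ _ cV cE; congr centered; apply/funext => w.
by ring.
Qed.

(* [condE] is [-oo] where the conditional expectation of the negative part is infinite,
   so that only events with integrable negative part have to be tested. *)
Lemma condE_le (Z V : T -> R) : measurable_fun setT Z -> measurable_wrt G V ->
  integrable_rv P V ->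
  (forall A, G A -> (\int[P]_(w in A) ((EFin \o Z)^\- w) < +oo)%E ->
     P.-integrable A (EFin \o Z) /\
     (\int[P]_(w in A) (Z w)%:E <= \int[P]_(w in A) (V w)%:E)%E) ->
  {ae P, forall w, (condE CE i (EFin \o Z) w <= (V w)%:E)%E}.
Proof.
move=> mZ mV iV H.
have mZE : measurable_fun setT (EFin \o Z) by exact/measurable_EFinP.
have mp := measurable_funepos mZE; have mn := measurable_funeneg mZE.
have [mEp Ep0 EpA] := condexpE _ mp (funepos_ge0 (EFin \o Z)).
have [mEn En0 EnA] := condexpE _ mn (funeneg_ge0 (EFin \o Z)).
set Ep := E _ in mEp Ep0 EpA; set En := E _ in mEn En0 EnA.
pose W w := (Ep w - En w - (V w)%:E)%E.
(* Where the claim fails, [En] is finite, since subtracting [+oo] gives [-oo]. Thus the failure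
   event is covered by the [A m], on each of which the negative part of [Z] is integrable and [H]
   applies. *)
pose A (m : nat) := [set w | (En w <= m%:R%:E)%E /\ (0 < W w)%E].
have GA m : G (A m).
  move/measurable_wrtP : mEp => mEp'; move/measurable_wrtP : mEn => mEn'.
  move/measurable_wrtP : mV => mV'.
  have -> : A m = En @^-1` `]-oo, m%:R%:E] `&` W @^-1` `]0%E, +oo[%classic.
    by apply/seteqP; split => w /=; rewrite !in_itv/= andbT.
  apply/sub_measurableP; apply: measurableI.
    by rewrite -[X in measurable X]setTI; apply: mEn' => //; exact: emeasurable_itv.
  rewrite -[X in measurable X]setTI.
  have mW : measurable_fun (setT : set (g_sigma_algebraType G)) W.
    rewrite /W; apply: emeasurable_funB; last exact/measurable_EFinP.
    exact: emeasurable_funB.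
  by apply: mW => //; exact: emeasurable_itv.
have PA m : P (A m) = 0%E.
  have mA := subG _ (GA m).
  have En_lt : (\int[P]_(w in A m) En w < +oo)%E.
    apply: (@le_lt_trans _ _ (\int[P]_(w in A m) (cst m%:R%:E w))%E).
      apply: ge0_le_integral => //.
      - by apply: measurable_funTS; exact: measurable_wrt_fun.
      - by move=> w [].
    rewrite integral_cst// lte_mul_pinfty// ?lee_fin//.
    by apply: le_lt_trans (probability_le1 P mA) _; exact: ltry.
  have En_int : (\int[P]_(w in A m) ((EFin \o Z)^\- w) < +oo)%E by rewrite -EnA.
  have [iZ ZV] := H _ (GA m) En_int.
  have iEn : P.-integrable (A m) En.
    apply/integrableP; split; first by apply: measurable_funTS; exact: measurable_wrt_fun.
    by under eq_integral do rewrite gee0_abs//.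
  have iEp : P.-integrable (A m) Ep.
    apply/integrableP; split; first by apply: measurable_funTS; exact: measurable_wrt_fun.
    under eq_integral do rewrite gee0_abs//.
    rewrite EpA//; apply: integral_funepos_lt_pinfty => //.
  have iVA : P.-integrable (A m) (EFin \o V) by exact: integrableS iV.
  apply: (positive_integral_le0_null (A m) W) => //.
  - by apply: integrableB => //; exact: integrableB.
  - rewrite integralB//; last exact: integrableB.
    rewrite integralB// EpA// EnA// -integralB//.
    + rewrite leeBlDr ?add0e.
        apply: le_trans ZV; rewrite le_eqVlt; apply/orP; left; apply/eqP.
        apply: eq_integral => w _.
        exact: (esym (congr1 (@^~ w) (funeposneg (EFin \o Z)))).
      by apply: integrable_fin_num.
    + exact: integrable_funepos.
    + exact: integrable_funeneg.
  - by move=> w [].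
have : P.-negligible (\bigcup_m A m).
  apply: negligible_bigcup => m; have mA := subG _ (GA m).
  by exists (A m); split => //; exact: PA.
apply: negligibleS => w /= /negP; rewrite -ltNge => VW.
have {}VW : ((V w)%:E < Ep w - En w)%E by exact: VW.
have Enfin : (En w < +oo)%E.
  rewrite ltey; apply/eqP => Eny; move: VW; rewrite Eny/=.
  by rewrite addeNy ltNge leNye.
have : En w \is a fin_num by rewrite ge0_fin_numE.
move=> /fineK En_eq; exists (Num.bound (fine (En w))) => //=; split.
  by rewrite -En_eq lee_fin ltW// archi_boundP// fine_ge0.
by rewrite /W sube_gt0.
Qed.

End ConditionalExpectation.

End SubSigmaAlgebra.

(** * Drivers, filtrations and local martingales *)

Section OrdCons.
Context {U : Type} {D : nat}.

(** Joins the scalar and the vector argument of the driver into one vector of length [D+1], with the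
    scalar at [ord0], so that one selection covers both; martingale increments and transform
    coefficients are indexed in the same way. *)
Definition ord_cons (x : U) (y : 'I_D -> U) (k : 'I_D.+1) : U :=
  if unlift ord0 k is Some k' then y k' else x.

Lemma ord_cons0 x y : ord_cons x y ord0 = x.
Proof. by rewrite /ord_cons unlift_none. Qed.

Lemma ord_consS x y k : ord_cons x y (lift ord0 k) = y k.
Proof. by rewrite /ord_cons liftK. Qed.

End OrdCons.

Section Driver.
Context {R : realType} {d : measure_display} {T : measurableType d} {D : nat}.
Variables (G : set (set T)) (g : T -> R -> ('I_D -> R) -> R).
Variables (a0 : T -> R) (a : 'I_D -> T -> R).
Hypothesis salgG : sigma_algebra setT G.
Hypothesis gmeas : forall y z, measurable_wrt G (fun w => g w y z).
Hypothesis glip : forall w y y' z z',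
  `|g w y z - g w y' z'| <= a0 w * `|y - y'| + \sum_(k < D) a k w * `|z k - z' k|.
Hypothesis gconc : forall w (lam : R) y1 y2 z1 z2, 0 <= lam <= 1 ->
  lam * g w y1 z1 + (1 - lam) * g w y2 z2 <=
  g w (lam * y1 + (1 - lam) * y2) (fun k => lam * z1 k + (1 - lam) * z2 k).

Let h w (v : 'I_D.+1 -> R) := g w (v ord0) (fun k => v (lift ord0 k)).

Let h_lip : lipschitz_field (ord_cons a0 a) h.
Proof.
move=> w v v'; rewrite big_ord_recl ord_cons0.
under eq_bigr do rewrite ord_consS.
exact: glip.
Qed.

Let h_meas v :
  measurable_fun (setT : set (g_sigma_algebraType G)) (h^~ v : g_sigma_algebraType G -> R).
Proof. by apply/(measurable_wrtP G salgG); exact: gmeas. Qed.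

Let h_cons w y (z : 'I_D -> T -> R) :
  h w (fun k => ord_cons y z k w) = g w (y w) (fun k => z k w).
Proof. by rewrite /h ord_cons0; congr g; apply/funext => k; rewrite ord_consS. Qed.

Lemma driver_measurable (y : T -> R) (z : 'I_D -> T -> R) :
  measurable_wrt G y -> (forall k, measurable_wrt G (z k)) ->
  measurable_wrt G (fun w => g w (y w) (fun k => z k w)).
Proof.
move=> my mz; apply/(measurable_wrtP G salgG).
under eq_fun do rewrite -h_cons.
apply: (@measurable_lipschitz_comp _ (g_sigma_algebraType G) R _ (ord_cons a0 a)) => // k.
by apply/(measurable_wrtP G salgG); rewrite /ord_cons; case: unlift.
Qed.

Lemma driver_supergradient (y : T -> R) (z : 'I_D -> T -> R) :
  measurable_wrt G y -> (forall k, measurable_wrt G (z k)) ->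
  exists (rho : T -> R) (sigma : 'I_D -> T -> R),
  [/\ measurable_wrt G rho, forall k, measurable_wrt G (sigma k),
      forall w, `|rho w| <= a0 w, forall k w, `|sigma k w| <= a k w &
      forall w u0 u, g w u0 u <= g w (y w) (fun k => z k w) +
        (rho w * (u0 - y w) + \sum_k sigma k w * (u k - z k w))].
Proof.
move=> my mz; pose x w := fun k => ord_cons y z k w.
(* Recentering at the random point [x w] makes the field vanish at [0], as the selection requires.
   Its measurability at fixed [v] now involves a random argument, hence the composition result for
   Lipschitz fields. *)
pose h' w v := h w (fun k => x w k + v k) - h w (x w).
have hx w : h w (x w) = g w (y w) (fun k => z k w) := h_cons w y z.
have h'l : lipschitz_field (ord_cons a0 a) h'.
  move=> w v v'; rewrite /h' [X in `|X|](_ : _ =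
    h w (fun k => x w k + v k) - h w (fun k => x w k + v' k)); last by ring.
  apply: le_trans (h_lip _ _ _) _; rewrite le_eqVlt; apply/orP; left; apply/eqP.
  by apply: eq_bigr => k _; congr (_ * `|_|); rewrite opprD addrACA subrr add0r.
have mx k : measurable_wrt G (fun w => x w k) by rewrite /x /ord_cons; case: unlift.
have h'm v : measurable_fun (setT : set (g_sigma_algebraType G))
    (h'^~ v : g_sigma_algebraType G -> R).
  apply: measurable_funB.
    apply: (@measurable_lipschitz_comp _ (g_sigma_algebraType G) R _ (ord_cons a0 a)
      h (fun k w => x w k + v k)) => // k.
    apply: measurable_funD; last exact: measurable_cst.
    exact/(measurable_wrtP G salgG).
  apply/(measurable_wrtP G salgG); under eq_fun do rewrite hx.
  exact: driver_measurable.
have [w|w lam v v' l01|q [mq qA qP]] :=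
    @measurable_supergradient _ (g_sigma_algebraType G) R _ (ord_cons a0 a) h' h'l h'm.
- by rewrite /h'; under eq_fun do rewrite addr0; rewrite subrr.
- rewrite /h'; have := gconc w lam (x w ord0 + v ord0) (x w ord0 + v' ord0)
    (fun k => x w (lift ord0 k) + v (lift ord0 k))
    (fun k => x w (lift ord0 k) + v' (lift ord0 k)) l01.
  rewrite [leLHS](_ : _ = lam * h w (fun k => x w k + v k) +
    (1 - lam) * h w (fun k => x w k + v' k))//.
  rewrite [leRHS](_ : _ = h w (fun k => x w k + (lam * v k + (1 - lam) * v' k))).
    by lra.
  by congr g; [|apply/funext => k]; ring.
exists (q ord0), (fun k => q (lift ord0 k)); split.
- exact/(measurable_wrtP G salgG).
- by move=> k; exact/(measurable_wrtP G salgG).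
- by move=> w; have := qA ord0 w; rewrite ord_cons0.
- by move=> k w; have := qA (lift ord0 k) w; rewrite ord_consS.
- move=> w u0 u; pose v := ord_cons (u0 - y w) (fun k => u k - z k w).
  have v0 : v ord0 = u0 - y w by rewrite /v ord_cons0.
  have vS k : v (lift ord0 k) = u k - z k w by rewrite /v ord_consS.
  have hv : h w (fun k => x w k + v k) = g w u0 u.
    rewrite /h v0 /x ord_cons0 addrC subrK; congr g; apply/funext => k.
    by rewrite vS ord_consS addrC subrK.
  have := qP w v; rewrite big_ord_recl v0 /h' hv hx lerBlDl.
  by under eq_bigr do rewrite vS.
Qed.

End Driver.

Section Filtration.
Context {R : realType} {d : measure_display} {T : measurableType d}.
Variables (P : probability T R) (n : nat) (F : nat -> set (set T)).
Variable CE : nat -> (T -> \bar R) -> T -> \bar R.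
Hypothesis hF : filtration n F.
Hypothesis hCE : cond_exp_op P n F CE.

Lemma filtration_sigma_algebra {j} : (j <= n)%N -> sigma_algebra setT (F j).
Proof. exact: hF.1. Qed.

Lemma filtration_sub {j} : (j <= n)%N -> forall A, F j A -> measurable A.
Proof. by move=> jn A; exact: hF.2.1. Qed.

Lemma filtration_condexp {j} : (j <= n)%N -> forall X, measurable_fun setT X ->
  (forall w, 0 <= X w)%E ->
  [/\ measurable_wrt (F j) (CE j X), (forall w, 0 <= CE j X w)%E &
      forall A, F j A -> (\int[P]_(w in A) CE j X w = \int[P]_(w in A) X w)%E].
Proof. by move=> jn X mX X0; exact: hCE. Qed.

Lemma measurable_wrt_mono i j d' (U : measurableType d') (X : T -> U) :
  (i <= j <= n)%N -> measurable_wrt (F i) X -> measurable_wrt (F j) X.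
Proof. by move=> ij mX B mB; apply: (hF.2.2 i j) => //; exact: mX. Qed.

(** The tower property: the smaller sigma-algebra offers fewer test events. *)
Lemma centered_mono i j (X : T -> R) :
  (i <= j <= n)%N -> centered P (F j) X -> centered P (F i) X.
Proof. by move=> ij [iX X0]; split => // A FA; apply: X0; exact: (hF.2.2 i j). Qed.

Lemma martingale_centered (M : nat -> T -> R) : martingale P n F CE M ->
  forall j, (j < n)%N -> centered P (F j) (fun w => M j.+1 w - M j w).
Proof.
move=> [aM [iM mM]] j jn.
have jn' := ltnW jn.
have := condER_centered P _ (filtration_sigma_algebra jn') (filtration_sub jn') _ _
  (filtration_condexp jn') _ (iM j.+1 jn).
apply: centered_ae.
  exact: filtration_sub.
  by apply: measurable_funB; apply: (integrable_rv_measurable P); apply: iM.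
by apply: filterS (mM j jn) => w ->.
Qed.

Lemma doobS (V : nat -> T -> R) j :
  doob CE V j.+1 = fun w => doob CE V j w + (V j.+1 w - condER CE j (V j.+1) w).
Proof. by apply/funext => w; rewrite /doob big_ord_recr. Qed.

(** [doob] reads [V] at the times [1, ..., n], which is why the hypotheses start at [1]: [beta] is
    specified only from time [1] on. *)
Lemma doob_martingale (V : nat -> T -> R) :
  (forall j, (1 <= j <= n)%N -> measurable_wrt (F j) (V j)) ->
  (forall j, (1 <= j <= n)%N -> integrable_rv P (V j)) ->
  martingale P n F CE (doob CE V).
Proof.
move=> aV iV.
have iM j : (j <= n)%N -> integrable_rv P (doob CE V j).
  elim: j => [_|j IH jn].
    rewrite /doob; under eq_fun do rewrite big_ord0.
    by apply: (integrable_rv_bounded P 0) => // w; rewrite normr0.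
  rewrite doobS.
  apply: integrable_rvD; first exact/IH/ltnW.
  apply: integrable_rvB; first exact: iV.
  apply: (condER_integrable P _ (filtration_sigma_algebra (ltnW jn))
    (filtration_sub (ltnW jn)) _ _ (filtration_condexp (ltnW jn))).
  exact: iV.
have aM : adapted_upto n F (doob CE V).
  move=> j; elim: j => [_|j IH jn].
    apply/(measurable_wrtP _ (filtration_sigma_algebra (leq0n n))).
    by rewrite /doob; under eq_fun do rewrite big_ord0; exact: measurable_cst.
  have jn' := ltnW jn.
  apply/(measurable_wrtP _ (filtration_sigma_algebra jn)).
  rewrite doobS.
  apply: measurable_funD.
    apply/(measurable_wrtP _ (filtration_sigma_algebra jn)).
    by apply: (measurable_wrt_mono j); [rewrite leqnSn|exact: IH].
  apply: measurable_funB.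
    by apply/(measurable_wrtP _ (filtration_sigma_algebra jn)); exact: aV.
  apply/(measurable_wrtP _ (filtration_sigma_algebra jn)).
  apply: (measurable_wrt_mono j); first by rewrite leqnSn.
  apply: (condER_measurable P _ (filtration_sigma_algebra jn') _ _ (filtration_condexp jn')).
  by apply: (integrable_rv_measurable P); exact: iV.
split => //; split => // j jn; have jn' := ltnW jn.
have H : {ae P, forall w, condER CE j (doob CE V j.+1) w = doob CE V j w}.
  apply: (condER_unique P _ (filtration_sigma_algebra jn') (filtration_sub jn') _ _
    (filtration_condexp jn')).
  - exact: iM.
  - exact: aM.
  - rewrite doobS; under eq_fun do rewrite addrAC subrr add0r.
    apply: (condER_centered P _ (filtration_sigma_algebra jn') (filtration_sub jn') _ _
      (filtration_condexp jn')).
    exact: iV.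
by apply: filterS H => w ->.
Qed.

(* A discrete-time local martingale with integrable terminal positive part is a
   martingale: positive parts are handled backwards, then full integrability forwards. *)
Lemma local_martingale_centered (N : nat -> T -> R) i : (i <= n)%N ->
  (forall j, (i <= j <= n)%N -> measurable_wrt (F j) (N j)) ->
  (forall j, (i <= j < n)%N -> locally_centered P (F j) (fun w => N j.+1 w - N j w)) ->
  integrable_rv P (N i) -> integrable_rv P (fun w => Num.max (N n w) 0) ->
  integrable_rv P (N n) /\ centered P (F i) (fun w => N n w - N i w).
Proof.
move=> lein aN lN iNi iNn.
have ip k : (k <= n - i)%N -> integrable_rv P (fun w => Num.max (N (n - k)%N w) 0).
  elim: k => [|k IH] kn; first by rewrite subn0.
  have e : (n - k = (n - k.+1).+1)%N by lia.
  have jn : (n - k.+1 <= n)%N by lia.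
  apply: (locally_centered_pos_integrable P _ (filtration_sigma_algebra jn)
    (filtration_sub jn) _ (N (n - k)%N)).
  - by apply: aN; lia.
  - by rewrite e; apply: lN; lia.
  - by apply: IH; lia.
have ii k : (k <= n - i)%N -> integrable_rv P (N (i + k)%N) /\
    centered P (F i) (fun w => N (i + k)%N w - N i w).
  elim: k => [_|k IH kn].
    rewrite addn0; split => //; under eq_fun do rewrite subrr.
    exact: centered0.
  have [iNk cNk] := IH (ltnW kn).
  have jn : (i + k <= n)%N by lia.
  have [||||iS cS] := locally_centered_step P _ (filtration_sigma_algebra jn)
    (filtration_sub jn) (N (i + k)%N) (N (i + k).+1).
  - by [].
  - apply: (measurable_wrt_fun (F (i + k).+1)); first by apply: filtration_sub; lia.
    by apply: aN; lia.
  - by apply: lN; lia.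
  - by rewrite (_ : (i + k).+1 = (n - (n - (i + k).+1))%N); [apply: ip|]; lia.
  rewrite addnS; split => //.
  have := centeredD P _ (filtration_sub lein) _ _ (centered_mono i _ _ _ cS) cNk.
  rewrite jn leq_addr => /(_ isT); congr centered; apply/funext => w.
  by rewrite addrA subrK.
by have := ii (n - i)%N (leqnn _); rewrite subnKC.
Qed.

End Filtration.

(** * The dynamic program and its lower bound *)

(** Recovers the first-hitting-time properties from the list encoding of [tau_star]; the default
    [i + k] is the horizon, where [p] is not asserted. *)
Lemma head_filter_iota (p : pred nat) (k i : nat) :
  let m := head (i + k)%N [seq j <- iota i k | p j] in
  [/\ (i <= m <= i + k)%N, (m < i + k)%N -> p m &
      forall j, (i <= j < m)%N -> ~~ p j].
Proof.
elim: k i => [|k IH] i /=.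
  by split => [||j]; rewrite addn0 ?leqnn ?ltnn// => /andP[/leq_ltn_trans h /h]; rewrite ltnn.
case: ifPn => [pi|npi] /=.
  by split => // [|j /andP[/leq_ltn_trans h /h]]; rewrite ?leqnn ?leq_addr// ltnn.
have := IH i.+1; rewrite addSnnS; set m := head _ _; move=> [/andP[im mk] pm nj].
split=> //; first by rewrite (ltnW im).
move=> j /andP[ij jm]; have [->//|ji] := eqVneq j i; apply: nj.
by rewrite jm andbT ltn_neqAle eq_sym ji.
Qed.

(** Discrete variation of constants: nonnegative factors preserve the inequality while it is
    unrolled from [i] to [t]. The weight of [x l] contains [a l] but not [b l], because [x l] enters
    beside the product with [b l]. *)
Lemma linear_recursion_le (R : realType) (Dl a b x : nat -> R) (i t : nat) : (i <= t)%N ->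
  (forall j, (i <= j < t)%N ->
     [/\ 0 <= a j, 0 <= b j & Dl j <= a j * (b j * Dl j.+1 - x j)]) ->
  Dl t <= 0 ->
  Dl i <= - \sum_(i <= l < t) (\prod_(i <= m < l) (a m * b m)) * a l * x l.
Proof.
move=> it H Dt.
pose C j := \prod_(i <= m < j) (a m * b m).
have C0 j : (j <= t)%N -> 0 <= C j.
  move=> jt; rewrite /C big_seq; apply: prodr_ge0 => m.
  rewrite mem_index_iota => /andP[im mj].
  have [|a0 b0 _] := H m; first by rewrite im (leq_trans mj).
  exact: mulr_ge0.
suff S k : (i + k <= t)%N ->
    Dl i <= C (i + k)%N * Dl (i + k)%N - \sum_(i <= l < i + k) C l * a l * x l.
  have := S (t - i)%N; rewrite subnKC// => /(_ (leqnn _)) /le_trans; apply.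
  by rewrite gerDr mulr_ge0_le0// C0.
elim: k => [_|k IH kt].
  by rewrite addn0 /C !big_geq// mul1r subr0.
rewrite addnS in kt *; apply: (le_trans (IH (ltnW kt))).
have CS : C (i + k).+1 = C (i + k)%N * (a (i + k)%N * b (i + k)%N).
  by rewrite /C big_nat_recr ?leq_addr.
rewrite big_nat_recr ?leq_addr//= CS.
have [|a0 b0 Hk] := H (i + k)%N; first by rewrite leq_addr.
have := ler_wpM2l (C0 _ (ltnW kt)) Hk; lra.
Qed.

Section AlmostEverywhere.
Context {R : realType} {d : measure_display} {T : measurableType d}.
Variable P : probability T R.

Lemma ae_below (n : nat) (Q : nat -> T -> Prop) :
  (forall j, (j < n)%N -> {ae P, forall w, Q j w}) ->
  {ae P, forall w, forall j, (j < n)%N -> Q j w}.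
Proof.
move=> H; apply: ae_foralln => j; have [jn|nj] := ltnP j n.
  by apply: filterS (H j jn).
exact: aeW.
Qed.

Lemma integrable_rv_le_ae (X Y : T -> R) : measurable_fun setT X ->
  {ae P, forall w, `|X w| <= Y w} -> integrable_rv P Y -> integrable_rv P X.
Proof.
move=> mX XY iY; have mY := integrable_rv_measurable P _ iY.
have mN : measurable_fun setT (fun w => `|X w|) by exact: measurableT_comp.
have i1 : integrable_rv P (fun w => Num.min `|X w| `|Y w|).
  apply: (integrable_rv_le P _ Y) => //.
    by apply: measurable_minr => //; exact: measurableT_comp.
  by move=> w; rewrite ger0_norm ?le_min ?normr_ge0// ge_min lexx orbT.
have i2 : integrable_rv P (fun w => `|X w|).
  apply: integrable_rv_ae i1 => //; apply: filterS XY => w XYw.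
  by rewrite min_l// (le_trans XYw)// ler_norm.
by apply: integrable_rv_le i2 => // w; rewrite normr_id.
Qed.

Lemma le_integral_rv_ae (X Y : T -> R) : integrable_rv P X -> integrable_rv P Y ->
  {ae P, forall w, X w <= Y w} -> (\int[P]_w (X w)%:E <= \int[P]_w (Y w)%:E)%E.
Proof.
move=> iX iY XY.
have mX := integrable_rv_measurable P _ iX; have mY := integrable_rv_measurable P _ iY.
have mm : measurable_fun setT (fun w => Num.min (X w) (Y w)) by exact: measurable_minr.
have XmE : {ae P, forall w, X w = Num.min (X w) (Y w)}.
  by apply: filterS XY => w XYw; rewrite min_l.
have im := integrable_rv_ae P _ _ mm XmE iX.
rewrite (ae_eq_integral (fun w => (Num.min (X w) (Y w))%:E))//.
- by apply: le_integral => // w _; rewrite lee_fin ge_min lexx orbT.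
- exact/measurable_EFinP.
- exact/measurable_EFinP.
- by apply: filterS XmE => w /= <-.
Qed.

End AlmostEverywhere.

Section Bsde.
Context {R : realType} {d : measure_display} {T : measurableType d}.
Variables (P : probability T R) (n D : nat) (F : nat -> set (set T)).
Hypothesis hF : filtration n F.
Variable CE : nat -> (T -> \bar R) -> T -> \bar R.
Hypothesis hCE : cond_exp_op P n F CE.
Variable Delta : nat -> R.
Hypothesis hDelta : forall i, (i < n)%N -> 0 < Delta i.
Variable S : nat -> T -> \bar R.
Hypothesis hS_adapt : forall i, (i <= n)%N -> measurable_wrt (F i) (S i).
Hypothesis hS_n : forall w, S n w \is a fin_num.
Variable f : T -> nat -> R -> ('I_D -> R) -> R.
Hypothesis hf_adapt : forall i y z, (i < n)%N -> measurable_wrt (F i) (fun w => f w i y z).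
Variables (alpha0 : nat -> T -> R) (alpha : 'I_D -> nat -> T -> R).
Hypothesis halpha_adapt : forall k, adapted_upto n F (alpha k).
Hypothesis halpha_ge0 : forall k i w, 0 <= alpha k i w.
Hypothesis hlip : forall i w y y' (z z' : 'I_D -> R), (i < n)%N ->
  `|f w i y z - f w i y' z'|
    <= alpha0 i w * `|y - y'| + \sum_(k < D) alpha k i w * `|z k - z' k|.
Variable beta : nat -> T -> 'I_D -> R.
Hypothesis hbeta_adapt : forall i k, (1 <= i <= n)%N ->
  measurable_wrt (F i) (fun w => beta i w k).
Hypothesis hbeta_bdd : exists C : R, forall i w k, (1 <= i <= n)%N -> `|beta i w k| <= C.
Hypothesis hcontr : forall i, (i < n)%N -> {ae P, forall w,
  alpha0 i w < 1 / Delta i /\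
  \sum_(k < D) alpha k i w * `|beta i.+1 w k| <= 1 / Delta i}.
Variable Y : nat -> T -> R.
Hypothesis hY_adapt : adapted_upto n F Y.
Hypothesis hY_int : forall i, (i <= n)%N -> integrable_rv P (Y i).
Hypothesis hY_n : {ae P, forall w, (Y n w)%:E = S n w}.
Hypothesis hY_rec : forall i, (i < n)%N -> {ae P, forall w,
  (Y i w)%:E = Order.max (S i w) (cont_value CE f beta Delta Y i w)%:E}.

Local Notation salg hj := (filtration_sigma_algebra n F hF hj).
Local Notation subm hj := (filtration_sub n F hF hj).
Local Notation cexp hj := (filtration_condexp P n F CE hCE hj).
Local Notation betaY k := (fun j w => beta j w k * Y j w).
Local Notation zeta j k := (condER CE j (betaY k j.+1)).
Local Notation M0_s := (doob CE Y).
Local Notation M_s := (fun j w k => doob CE (betaY k) j w).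

Lemma betaY_measurable j k : (1 <= j <= n)%N -> measurable_wrt (F j) (betaY k j).
Proof.
move=> jn; have /andP[_ jn'] := jn.
apply: (measurable_wrtM _ (salg jn')); first exact: hbeta_adapt.
exact: hY_adapt.
Qed.

Lemma betaY_integrable j k : (1 <= j <= n)%N -> integrable_rv P (betaY k j).
Proof.
move=> jn; have /andP[_ jn'] := jn; have [C hC] := hbeta_bdd.
apply: (integrable_rv_boundedM P C) => [|w|]; last exact: hY_int.
  by apply: (measurable_wrt_fun (F j)); [exact: (subm jn')|exact: hbeta_adapt].
exact: hC.
Qed.

Lemma zeta_measurable j k : (j < n)%N -> measurable_wrt (F j) (zeta j k).
Proof.
move=> jn; apply: (condER_measurable P _ (salg (ltnW jn)) _ _ (cexp (ltnW jn))).
by apply: (integrable_rv_measurable P); exact: betaY_integrable.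
Qed.

Lemma driver_value_measurable j : (j < n)%N ->
  measurable_wrt (F j) (fun w => f w j (Y j w) (fun k => zeta j k w)).
Proof.
move=> jn.
apply: (driver_measurable _ (fun w => f w j) (alpha0 j) (fun k => alpha k j) (salg (ltnW jn))
  _ _ (Y j) (fun k => zeta j k)).
- by move=> y z; exact: hf_adapt.
- by move=> w y y' z z'; exact: hlip.
- exact/hY_adapt/ltnW.
- by move=> k; exact: zeta_measurable.
Qed.

Lemma cont_value_measurable j : (j < n)%N ->
  measurable_wrt (F j) (cont_value CE f beta Delta Y j).
Proof.
move=> jn; have jn' := ltnW jn; apply/(measurable_wrtP _ (salg jn')).
apply: measurable_funD.
  apply/(measurable_wrtP _ (salg jn')).
  apply: (condER_measurable P _ (salg jn') _ _ (cexp jn')).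
  by apply: (integrable_rv_measurable P); exact: hY_int.
apply: measurable_funM; last exact: measurable_cst.
exact/(measurable_wrtP _ (salg jn'))/driver_value_measurable.
Qed.

(** The weighted integrability rests on the contraction bound: [alpha_k |beta_k Y|] is at most
    [|Y| / Delta] almost surely. The conditional expectation in each Doob increment inherits this
    through [integrable_mul_condER]. *)
Lemma doob_mart_pairs : mart_pairs P n D F CE alpha M0_s M_s.
Proof.
split; [|split].
- apply: doob_martingale => // j /andP[_ jn]; [exact: hY_adapt|exact: hY_int].
- move=> k; apply: (doob_martingale P n F CE hF hCE (betaY k)) => j jn.
    exact: betaY_measurable.
  exact: betaY_integrable.
- move=> k j jn; have jn' := ltnW jn.
  have iB : integrable_rv P (betaY k j.+1) by exact: betaY_integrable.
  have ma : measurable_fun setT (alpha k j).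
    by apply: (measurable_wrt_fun (F j)); [exact: (subm jn')|exact: halpha_adapt].
  have i1 : integrable_rv P (fun w => alpha k j w * `|betaY k j.+1 w|).
    apply: (integrable_rv_le_ae P _ (fun w => (1 / Delta j) * `|Y j.+1 w|)).
    + apply: measurable_funM => //; apply: measurableT_comp => //.
      exact: integrable_rv_measurable iB.
    + apply: filterS (hcontr j jn) => w [_ hc].
      rewrite normrM normr_id ger0_norm// normrM mulrA ler_wpM2r//.
      apply: le_trans hc; rewrite (bigD1 k)//= lerDl; apply: sumr_ge0 => l _.
      exact: mulr_ge0.
    + apply: (integrable_rv_boundedM P `|1 / Delta j|) => //.
      exact: (integrable_norm (hY_int _ jn)).
  have i2 := integrable_mul_condER P _ (salg jn') (subm jn') _ _ (cexp jn') _ _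
    (halpha_adapt k j jn') (halpha_ge0 k j) iB i1.
  apply: integrable_rv_le (integrable_rvD P _ _ i1 i2).
    apply: measurable_funM => //; apply: measurableT_comp => //.
    apply: measurable_funB; apply: (measurable_wrt_fun (F j.+1)); try exact: (subm jn).
      by apply: (doob_martingale P n F CE hF hCE (betaY k) _ _).1 => // l ln;
        [exact: betaY_measurable|exact: betaY_integrable].
    apply: (measurable_wrt_mono n F hF j); first by rewrite leqnSn.
    by apply: (doob_martingale P n F CE hF hCE (betaY k) _ _).1 => // l ln;
      [exact: betaY_measurable|exact: betaY_integrable].
  move=> w; rewrite doobS addrAC subrr add0r -mulrDr [leLHS]normrM [leRHS]normrM normr_id.
  rewrite ler_wpM2l// [leRHS]ger0_norm ?addr_ge0//.
  exact: ler_normB.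
Qed.

(** * The stopping time [tau_star] and attainment *)

Variable i : nat.
Hypothesis hi : (i <= n)%N.
Local Notation tau_s := (tau_star n CE S f beta Delta Y i).
Local Notation cont := (cont_value CE f beta Delta Y).

Lemma tau_starP w : [/\ (i <= tau_s w <= n)%N,
  (tau_s w < n)%N -> ((cont (tau_s w) w)%:E <= S (tau_s w) w)%E &
  forall j, (i <= j < tau_s w)%N -> (S j w < (cont j w)%:E)%E].
Proof.
have := head_filter_iota (fun j => ((cont j w)%:E <= S j w)%E) (n - i) i.
rewrite subnKC// -/(tau_s w) => -[h1 h2 h3]; split => // j ij.
by rewrite ltNge h3.
Qed.

Lemma tau_star_barS : barS n F S i tau_s.
Proof.
split; [split|split] => w.
- by have [/andP[]] := tau_starP w.
- rename w into j; move=> jn.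
  pose E l := [set w | ((cont l w)%:E <= S l w)%E].
  have GE l : (l <= j)%N -> (l < n)%N -> measurable (E l : set (g_sigma_algebraType (F j))).
    move=> lj ln; rewrite -[E l]setTI.
    have lj' : (l <= j <= n)%N by rewrite lj.
    apply: measurable_lee => //.
      apply/measurable_EFinP/(measurable_wrtP _ (salg jn)).
      by apply: (measurable_wrt_mono n F hF l) => //; exact: cont_value_measurable.
    apply/(measurable_wrtP _ (salg jn)).
    by apply: (measurable_wrt_mono n F hF l) => //; exact/hS_adapt/ltnW.
  (* No hit strictly before [j], and a hit at [j] unless [j = n], where stopping is forced. *)
  have -> : [set w | tau_s w = j] = (if (i <= j)%N then setT else set0) `&`
      (\bigcap_(l in [set l | (i <= l < j)%N]) ~` E l) `&`
      (if (j < n)%N then E j else setT).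
    apply/seteqP; split => w /=.
      have [/andP[it tn] tS nS] := tau_starP w; move=> tj; rewrite tj in it tn tS nS.
      rewrite it; split; first split => //.
        by move=> l ij; rewrite /E /=; apply/negP; rewrite -ltNge nS.
      by case: ifPn => // jn'; exact: tS.
    case: ifPn => [ij|_ [[]]//] [[_ H1] H2].
    have [/andP[it tn] tS nS] := tau_starP w.
    have [tj|jt|//] := ltngtP (tau_s w) j.
      have := H1 (tau_s w); rewrite /= it tj => /(_ isT); case.
      by rewrite /E /= tS// (leq_trans tj).
    have := nS j; rewrite ij jt => /(_ isT); move: H2.
    by rewrite (leq_trans jt tn) /E /= leNgt => /negbTE ->.
  apply/(sub_measurableP _ (salg jn)).
  apply: measurableI; first apply: measurableI.
  + by case: ifP.
  + apply: bigcap_measurableType => l /= /andP[il lj]; apply: measurableC; apply: GE.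
      exact: ltnW.
    exact: leq_trans lj jn.
  + by case: ifPn => // jn'; exact: GE.
- by have [/andP[]] := tau_starP w.
(* [S] stays above [-oo] at the stopping time: before [n] it dominates the real number [cont], and
   at [n] it is finite. *)
- have [/andP[_ tn] tS _] := tau_starP w.
  move: tn; rewrite leq_eqVlt => /orP[/eqP ->|/tS]; last first.
    by case: (S _ _).
  by have := hS_n w; case: (S n w).
Qed.

Lemma Y_tau_star w : (Y n w)%:E = S n w ->
  (forall j, (j < n)%N -> (Y j w)%:E = Order.max (S j w) (cont j w)%:E) ->
  (Y (tau_s w) w)%:E = S (tau_s w) w /\
  forall j, (i <= j < tau_s w)%N -> Y j w = cont j w.
Proof.
move=> Yn Yrec; have [/andP[it tn] tS nS] := tau_starP w; split.
  move: tn; rewrite leq_eqVlt => /orP[/eqP ->//|tn].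
  by rewrite Yrec// max_l// tS.
move=> j ij; have jt : (j < n)%N by case/andP: ij => _ /leq_trans; apply.
by apply: EFin_inj; rewrite Yrec// max_r// ltW// nS.
Qed.

(** Subtracting a Doob increment from the next value leaves exactly its conditional expectation. The
    continuation value thus becomes a pathwise expression, which is why optimality holds path by
    path. *)
Lemma cont_value_doob j w : cont j w = Y j.+1 w - (M0_s j.+1 w - M0_s j w)
  + f w j (Y j w) (fun k => beta j.+1 w k * Y j.+1 w - (M_s j.+1 w k - M_s j w k)) * Delta j.
Proof.
rewrite /cont_value !doobS; congr (_ + f w j _ _ * _); first by ring.
by apply/funext => k; rewrite doobS; ring.
Qed.

Lemma theta_low_tau_star theta :
  theta_low P S f beta Delta i tau_s M0_s M_s theta -> {ae P, forall w, theta i w = Y i w}.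
Proof.
move=> [_ hth].
apply: filterS3 (filterI hth hY_n) (ae_below P n _ hY_rec) (ae_below P n _ hcontr).
move=> w [[thS threc] Yn] Yrec hc.
have [Yt Yc] := Y_tau_star w Yn Yrec.
have [/andP[it tn] _ _] := tau_starP w.
suff H k : (k <= tau_s w - i)%N -> theta (tau_s w - k)%N w = Y (tau_s w - k)%N w.
  by have := H (tau_s w - i)%N (leqnn _); rewrite subKn.
elim: k => [_|k IH kt]; first by rewrite subn0; apply: EFin_inj; rewrite thS.
have e : (tau_s w - k = (tau_s w - k.+1).+1)%N by lia.
set j := (tau_s w - k.+1)%N in e *.
have ij : (i <= j)%N by rewrite /j; lia.
have jt : (j < tau_s w)%N by rewrite /j; lia.
have jn : (j < n)%N by exact: leq_trans jt tn.
have := IH (ltnW kt); rewrite e => thj.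
have := threc j ij jt; have := Yc j; rewrite ij jt => /(_ isT).
(* Since [theta] and [Y] agree at time [j+1], both solve the same implicit equation with the same
   [z]; only the dependence of [f] on its scalar argument remains. *)
rewrite cont_value_doob thj; set z := fun k => _; move=> Yj thj'.
have [ha _] := hc j jn; have D0 := hDelta j jn.
have := hlip j w (theta j w) (Y j w) z z jn.
rewrite [X in _ <= _ + X]big1 ?addr0; last by move=> l _; rewrite subrr normr0 mulr0.
move=> hl; apply/eqP; rewrite -subr_eq0 -normr_eq0; apply/negPn/negP => neq0.
have pos : 0 < `|theta j w - Y j w| by rewrite lt_neqAle eq_sym neq0 normr_ge0.
have : `|theta j w - Y j w| = `|f w j (theta j w) z - f w j (Y j w) z| * Delta j.
  have e2 : theta j w - Y j w = (f w j (theta j w) z - f w j (Y j w) z) * Delta j.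
    by move: thj' Yj; lra.
  by rewrite e2 normrM (gtr0_norm D0).
move: ha; rewrite ltr_pdivlMr// => ha.
have := ler_wpM2r (ltW D0) hl.
have : alpha0 j w * `|theta j w - Y j w| * Delta j < `|theta j w - Y j w|.
  by rewrite mulrAC gtr_pMl.
lra.
Qed.

(** Supplies a member of the family at the optimal triple. The extension by zero is there because
    [theta_low] asks for measurability at every index, while [Y] is controlled up to [n]. *)
Lemma theta_low_Y : theta_low P S f beta Delta i tau_s M0_s M_s
  (fun j => if (j <= n)%N then Y j else fun=> 0).
Proof.
split=> [j|].
  case: ifPn => jn; last exact: measurable_cst.
  by apply: (integrable_rv_measurable P); exact: hY_int.
apply: filterS2 hY_n (ae_below P n _ hY_rec) => w Yn Yrec.
have [Yt Yc] := Y_tau_star w Yn Yrec.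
have [/andP[it tn] _ _] := tau_starP w.
rewrite tn; split => // j ij jt; have jn : (j < n)%N by exact: leq_trans jt tn.
by rewrite jn (ltnW jn) {1}Yc ?ij// cont_value_doob.
Qed.

Hypothesis hconcave : forall w i, (i < n)%N -> forall (lam : R) y1 y2 (z1 z2 : 'I_D -> R),
  0 <= lam <= 1 ->
  lam * f w i y1 z1 + (1 - lam) * f w i y2 z2
    <= f w i (lam * y1 + (1 - lam) * y2) (fun k => lam * z1 k + (1 - lam) * z2 k).

(** * The upper bound for an arbitrary admissible triple *)

Section UpperBound.
Variables (tau : T -> nat) (M0 : nat -> T -> R) (M : nat -> T -> 'I_D -> R).
Variable theta : nat -> T -> R.
Hypothesis htau : barS n F S i tau.
Hypothesis hM : mart_pairs P n D F CE alpha M0 M.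
Hypothesis htheta : theta_low P S f beta Delta i tau M0 M theta.

(** Increments from [j] to [j+1] of [M0] and [M], each minus the matching Doob increment of [Y] or
    [beta Y]; the noise that separates [theta] from [Y]. *)
Let X j : 'I_D.+1 -> T -> R := ord_cons
  (fun w => (M0 j.+1 w - M0 j w) - (Y j.+1 w - condER CE j (Y j.+1) w))
  (fun k w => (M j.+1 w k - M j w k) - (beta j.+1 w k * Y j.+1 w - zeta j k w)).

Lemma increment_centered j k : (j < n)%N -> centered P (F j) (X j k).
Proof.
move=> jn; have jn' := ltnW jn; have [mM0 [mM _]] := hM.
rewrite /X /ord_cons; case: unlift => [k'|].
  apply: (centeredB P _ (subm jn')).
    exact: (martingale_centered P n F CE hF hCE (fun j w => M j w k')).
  apply: (condER_centered P _ (salg jn') (subm jn') _ _ (cexp jn')).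
  exact: betaY_integrable.
apply: (centeredB P _ (subm jn')).
  exact: (martingale_centered P n F CE hF hCE).
apply: (condER_centered P _ (salg jn') (subm jn') _ _ (cexp jn')).
exact: hY_int.
Qed.

Lemma increment_measurable j k : (j < n)%N -> measurable_wrt (F j.+1) (X j k).
Proof.
move=> jn; have jn' := ltnW jn; have [mM0 [mM _]] := hM.
have jj : (j <= j.+1 <= n)%N by rewrite leqnSn.
apply/(measurable_wrtP _ (salg jn)).
rewrite /X /ord_cons; case: unlift => [k'|]; apply: measurable_funB;
  apply: measurable_funB; apply/(measurable_wrtP _ (salg jn)).
- exact: (mM k').1.
- by apply: (measurable_wrt_mono n F hF j) => //; exact: (mM k').1.
- exact: betaY_measurable.
- by apply: (measurable_wrt_mono n F hF j) => //; exact: zeta_measurable.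
- exact: mM0.1.
- by apply: (measurable_wrt_mono n F hF j) => //; exact: mM0.1.
- exact: hY_adapt.
- apply: (measurable_wrt_mono n F hF j) => //.
  apply: (condER_measurable P _ (salg jn') _ _ (cexp jn')).
  by apply: (integrable_rv_measurable P); exact: hY_int.
Qed.

Lemma before_stopping_measurable j : (j <= n)%N -> F j [set w | (j < tau w)%N].
Proof.
move=> jn; apply/(sub_measurableP _ (salg jn)).
have -> : [set w | (j < tau w)%N] = ~` \bigcup_(l in [set l | (l <= j)%N]) [set w | tau w = l].
  apply/seteqP; split => w /=.
    by move=> jt [l /= lj tl]; move: jt; rewrite tl ltnNge lj.
  by move=> H; rewrite ltnNge; apply/negP => tj; apply: H; exists (tau w).
apply: measurableC; apply: bigcup_measurable => l /= lj.
apply/(sub_measurableP _ (salg jn)); apply: (hF.2.2 l j); first by rewrite lj.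
by apply: htau.1.2; exact: leq_trans lj jn.
Qed.

(* Linearizing the driver at [(Y, zeta)] by a measurable supergradient turns the recursion
   for [theta - Y] into a linear one, whose solution is a martingale transform. *)
Lemma theta_low_transform : exists H : nat -> 'I_D.+1 -> T -> R,
  (forall j k, (i <= j < n)%N -> measurable_wrt (F j) (H j k)) /\
  {ae P, forall w, theta i w <= Y i w - \sum_(i <= l < n) \sum_k H l k w * X l k w}.
Proof.
have /choice[q hq] : forall j, exists q : (T -> R) * ('I_D -> T -> R), (j < n)%N ->
    [/\ measurable_wrt (F j) q.1, forall k, measurable_wrt (F j) (q.2 k),
      forall w, `|q.1 w| <= alpha0 j w, forall k w, `|q.2 k w| <= alpha k j w &
      forall w u0 u, f w j u0 u <= f w j (Y j w) (fun k => zeta j k w) +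
        (q.1 w * (u0 - Y j w) + \sum_k q.2 k w * (u k - zeta j k w))].
  move=> j; have [jn|nj] := ltnP j n; last by exists (fun=> 0, fun _ _ => 0).
  have [|||||rho [sigma H]] := driver_supergradient (F j) (fun w => f w j) (alpha0 j)
    (fun k => alpha k j) (salg (ltnW jn)) _ _ _ (Y j) (fun k => zeta j k).
  - by move=> y z; exact: hf_adapt.
  - by move=> w y y' z z'; exact: hlip.
  - by move=> w lam y1 y2 z1 z2; exact: hconcave.
  - exact/hY_adapt/ltnW.
  - by move=> k; exact: zeta_measurable.
  by exists (rho, sigma).
pose rho j := (q j).1; pose sigma j := (q j).2.
(* The real power is measurable and nonnegative everywhere, and equals the inverse wherever the base
   is positive, which the contraction hypothesis ensures almost surely. *)
pose a j w := (1 - rho j w * Delta j) `^ (-1).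
pose b j w := 1 + Delta j * \sum_k sigma j k w * beta j.+1 w k.
(* Only [b m] with [m < l] occurs, and it reads [beta m.+1]; hence [C l] is [F l]-measurable, which
   would in general fail with the factor [b l]. *)
pose C l w := \prod_(i <= m < l) (a m w * b m w).
(* The indicator of [l < tau], an event of [F l], replaces the random upper limit [tau] of the sum
   by [n]. *)
pose W l w := \1_[set w | (l < tau w)%N] w * (C l w * a l w).
pose H l : 'I_D.+1 -> T -> R :=
  ord_cons (W l) (fun k w => W l w * (Delta l * sigma l k w)).
have mr j l : (j <= l <= n)%N -> (j < n)%N ->
    measurable_fun (setT : set (g_sigma_algebraType (F l))) (rho j : g_sigma_algebraType (F l) -> R).
  move=> jl jn; have /andP[_ ln] := jl; apply/(measurable_wrtP _ (salg ln)).
  by apply: (measurable_wrt_mono n F hF j) => //; have [] := hq j jn.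
have ms j l k : (j <= l <= n)%N -> (j < n)%N ->
    measurable_fun (setT : set (g_sigma_algebraType (F l))) (sigma j k : g_sigma_algebraType (F l) -> R).
  move=> jl jn; have /andP[_ ln] := jl; apply/(measurable_wrtP _ (salg ln)).
  apply: (measurable_wrt_mono n F hF j) => //.
  by have [_ h _ _ _] := hq j jn; exact: h.
have ma j l : (j <= l <= n)%N -> (j < n)%N ->
    measurable_fun (setT : set (g_sigma_algebraType (F l))) (a j : g_sigma_algebraType (F l) -> R).
  move=> jl jn; rewrite /a.
  apply: (measurableT_comp (f := fun x : R => x `^ (-1))); first exact: measurable_powR.
  apply: measurable_funB; first exact: measurable_cst.
  by apply: measurable_funM; [exact: mr|exact: measurable_cst].
have mb j l : (j < l <= n)%N ->
    measurable_fun (setT : set (g_sigma_algebraType (F l))) (b j : g_sigma_algebraType (F l) -> R).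
  move=> /andP[jl ln]; apply: measurable_funD; first exact: measurable_cst.
  apply: measurable_funM; first exact: measurable_cst.
  apply: measurable_sum => k; apply: measurable_funM.
    by apply: ms; [rewrite (ltnW jl)|exact: leq_trans jl ln].
  apply/(measurable_wrtP _ (salg ln)).
  apply: (measurable_wrt_mono n F hF j.+1); first by rewrite jl.
  by apply: hbeta_adapt; exact: leq_trans jl ln.
have mW l : (i <= l < n)%N ->
    measurable_fun (setT : set (g_sigma_algebraType (F l))) (W l : g_sigma_algebraType (F l) -> R).
  move=> /andP[il ln]; have ln' := ltnW ln; apply: measurable_funM.
    apply/(measurable_wrtP _ (salg ln')); apply: (measurable_wrt_indic _ (salg ln')).
    exact: before_stopping_measurable.
  apply: measurable_funM; last by apply: ma => //; rewrite leqnn.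
  apply: measurable_prod => m; rewrite mem_index_iota => /andP[im ml].
  apply: measurable_funM; last by apply: mb; rewrite ml.
  by apply: ma; [rewrite (ltnW ml)|exact: ltn_trans ml ln].
exists H; split=> [j k jn|].
  have /andP[_ /ltnW jn'] := jn; have /andP[_ jn2] := jn.
  apply/(measurable_wrtP _ (salg jn')); rewrite /H /ord_cons; case: unlift => [k'|].
    apply: measurable_funM; first exact: mW.
    apply: measurable_funM; first exact: measurable_cst.
    by apply: ms => //; rewrite leqnn.
  exact: mW.
have [_ hth] := htheta.
apply: filterS3 (filterI hth hY_n) (ae_below P n _ hY_rec) (ae_below P n _ hcontr).
move=> w [[thS threc] Yn] Yrec hc.
have it : (i <= tau w)%N := htau.2.1 w; have tn : (tau w <= n)%N := htau.1.1 w.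
pose xi j := X j ord0 w + Delta j * \sum_k sigma j k w * X j (lift ord0 k) w.
have HX l : \sum_k H l k w * X l k w = (l < tau w)%:R * (C l w * a l w * xi l).
  rewrite big_ord_recl /H ord_cons0.
  under eq_bigr => k _ do rewrite ord_consS -mulrA -mulrA.
  rewrite -mulr_sumr -mulr_sumr -mulrDr /W indicE.
  rewrite (_ : (w \in _) = (l < tau w)%N); first by rewrite mulrA.
  by apply/idP/idP => [/set_mem//|lt]; exact: mem_set.
have -> : \sum_(i <= l < n) \sum_k H l k w * X l k w =
    \sum_(i <= l < tau w) C l w * a l w * xi l.
  rewrite (big_cat_nat (n := tau w))//= [X in _ + X](_ : _ = 0) ?addr0; last first.
    by rewrite big_nat big1// => l /andP[tl _]; rewrite HX ltnNge tl mul0r.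
  by apply: eq_big_nat => l /andP[_ lt]; rewrite HX lt mul1r.
have Ytau : theta (tau w) w - Y (tau w) w <= 0.
  rewrite subr_le0 -lee_fin thS; move: tn; rewrite leq_eqVlt => /orP[/eqP ->|tn].
    by rewrite Yn.
  by rewrite Yrec// le_max lexx.
suff R1 j : (i <= j < tau w)%N -> [/\ 0 <= a j w, 0 <= b j w &
    theta j w - Y j w <= a j w * (b j w * (theta j.+1 w - Y j.+1 w) - xi j)].
  have := linear_recursion_le R (fun j => theta j w - Y j w) (a^~ w) (b^~ w) xi i (tau w) it R1 Ytau.
  by rewrite lerBlDl -/(C _ w).
move=> /andP[ij jt]; have jn : (j < n)%N by exact: leq_trans jt tn.
have [_ _ hrho hsigma hsup] := hq j jn; have D0 := hDelta j jn.
have [ha hb] := hc j jn.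
have rD : 0 < 1 - rho j w * Delta j.
  rewrite subr_gt0 -ltr_pdivlMr//; apply: le_lt_trans ha.
  by apply: le_trans (hrho w); exact: ler_norm.
split; first exact: powR_ge0.
- have : `|\sum_k sigma j k w * beta j.+1 w k| <= 1 / Delta j.
    apply: le_trans hb; apply: (le_trans (ler_norm_sum _ _ _)); apply: ler_sum => k _.
    by rewrite normrM ler_wpM2r//; exact: hsigma.
  rewrite ler_norml => /andP[h _]; have := ler_wpM2l (ltW D0) h.
  rewrite mulrN mul1r divff ?gt_eqF// /b; lra.
rewrite /a powR_inv1 ?(ltW rD)// ler_pdivlMl//.
have := threc j ij jt; set u := (fun k => _) => thj.
(* The recursion for [theta] is compared with [cont j w <= Y j w]. The supergradient bounds the
   difference of driver values, and its [rho] term moves to the left, producing the factor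
   [1 - rho Delta]. *)
have := hsup w (theta j w) u; rewrite -/(rho j) -/(sigma j).
have -> : \sum_k sigma j k w * (u k - zeta j k w) =
    (\sum_k sigma j k w * beta j.+1 w k) * (theta j.+1 w - Y j.+1 w) -
    \sum_k sigma j k w * X j (lift ord0 k) w.
  rewrite mulr_suml -sumrB; apply: eq_bigr => k _.
  by rewrite /u /X ord_consS; ring.
have : cont j w <= Y j w by rewrite -lee_fin Yrec// le_max lexx orbT.
have X0E : X j ord0 w = (M0 j.+1 w - M0 j w) - (Y j.+1 w - condER CE j (Y j.+1) w).
  by rewrite /X ord_cons0.
rewrite /xi /b X0E /cont_value.
set s1 := \sum_k _; set s2 := \sum_k _; set fY := f w j (Y j w) _.
set fT := f w j _ _ in thj *; move=> hY hf.
have := ler_wpM2l (ltW D0) hf; move: thj hY; lra.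
Qed.

Lemma theta_low_le : {ae P, forall w, (condE CE i (EFin \o theta i) w <= (Y i w)%:E)%E}.
Proof.
have [H [mH hH]] := theta_low_transform.
have mth : measurable_fun setT (theta i) by exact: htheta.1.
apply: (condE_le P _ (salg hi) (subm hi) _ _ (cexp hi)) => //.
- exact: hY_adapt.
- exact: hY_int.
move=> A FA iA; have mA := subm hi _ FA.
have m1A : measurable_fun setT (\1_A : T -> R) by exact: measurable_indic.
(* The indicator of [A] in [F i] keeps the coefficients adapted from time [i] on and confines all
   estimates to the event where the negative part of [theta i] is integrable. *)
pose N j w := \1_A w * \sum_(i <= l < j) \sum_k H l k w * X l k w.
have NS j w : (i <= j)%N -> N j.+1 w = N j w + \sum_k (\1_A w * H j k w) * X j k w.
  move=> ij; rewrite /N big_nat_recr//= mulrDr [X in _ + X]mulr_sumr.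
  by congr (_ + _); apply: eq_bigr => k _; rewrite mulrA.
have m1 j : (i <= j <= n)%N -> measurable_wrt (F j) (\1_A : T -> R).
  move=> ij; apply: (measurable_wrt_mono n F hF i) => //.
  exact: (measurable_wrt_indic _ (salg hi)).
have mN k : (i + k <= n)%N -> measurable_wrt (F (i + k)%N) (N (i + k)%N).
  elim: k => [_|k IH kn].
    rewrite addn0; apply/(measurable_wrtP _ (salg hi)).
    rewrite (_ : N i = cst 0); first exact: measurable_cst.
    by apply/funext => w; rewrite /N big_geq// mulr0.
  rewrite addnS in kn *; have kn' := ltnW kn.
  have kk : (i + k <= (i + k).+1 <= n)%N by rewrite leqnSn.
  rewrite (_ : N _ = fun w => N (i + k)%N w +
    \sum_l (\1_A w * H (i + k)%N l w) * X (i + k)%N l w); last first.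
    by apply/funext => w; rewrite NS// leq_addr.
  apply/(measurable_wrtP _ (salg kn)); apply: measurable_funD.
    apply/(measurable_wrtP _ (salg kn)); apply: (measurable_wrt_mono n F hF (i + k)) => //.
    exact: IH.
  apply: measurable_sum => l; apply: measurable_funM; last first.
    exact/(measurable_wrtP _ (salg kn))/increment_measurable.
  apply: measurable_funM.
    by apply/(measurable_wrtP _ (salg kn)); apply: m1; rewrite kn (leq_trans (leq_addr k i)).
  apply/(measurable_wrtP _ (salg kn)); apply: (measurable_wrt_mono n F hF (i + k)) => //.
  by apply: mH; rewrite leq_addr.
have mN' j : (i <= j <= n)%N -> measurable_wrt (F j) (N j).
  by move=> /andP[ij jn]; rewrite -(subnKC ij); apply: mN; rewrite subnKC.
have lN j : (i <= j < n)%N -> locally_centered P (F j) (fun w => N j.+1 w - N j w).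
  move=> /andP[ij jn]; have jn' := ltnW jn.
  have -> : (fun w => N j.+1 w - N j w) = fun w => \sum_k (\1_A w * H j k w) * X j k w.
    by apply/funext => w; rewrite NS// addrAC subrr add0r.
  apply: (transform_locally_centered P _ (salg jn') (subm jn') D.+1
    (fun k w => \1_A w * H j k w) (X j)) => k.
    apply: (measurable_wrtM _ (salg jn')); first by apply: m1; rewrite ij.
    by apply: mH; rewrite ij.
  exact: increment_centered.
have Ni0 w : N i w = 0 by rewrite /N big_geq// mulr0.
have iNi : integrable_rv P (N i).
  rewrite (_ : N i = fun=> 0); last exact/funext.
  by apply: (integrable_rv_bounded P 0) => // w; rewrite normr0.
have iYi := hY_int i hi.
have iYn : integrable_rv P (fun w => `|Y i w|) by exact: (integrable_norm iYi).
have ineg : integrable_rv P (fun w => \1_A w * Num.max (- theta i w) 0).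
  apply/integrableP; split.
    apply/measurable_EFinP; apply: measurable_funM => //.
    by apply: measurable_maxr; [exact: measurable_funN|exact: measurable_cst].
  move: iA; rewrite funerneg (integral_rv_indic P A); congr (_ < _)%E.
  apply: eq_integral => w _; rewrite /= ger0_norm// mulr_ge0//.
  by rewrite le_max lexx orbT.
have mNn : measurable_fun setT (N n).
  by apply: (measurable_wrt_fun (F n)); [exact: (subm (leqnn n))|apply: mN'; rewrite hi leqnn].
(* On [A] the transform bound reads [N n <= Y i - theta i], so the positive part is at most [|Y i|]
   plus the negative part of [theta i]; off [A] it vanishes. *)
have iNp : integrable_rv P (fun w => Num.max (N n w) 0).
  apply: (integrable_rv_le_ae P _ _ _ _ (integrable_rvD P _ _ iYn ineg)).
    by apply: measurable_maxr => //; exact: measurable_cst.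
  apply: filterS hH => w thw; rewrite /N indicE.
  have h3 := ler_norm (Y i w); have h4 := normr_ge0 (Y i w).
  case: (_ \in _); rewrite ?mul1r ?mul0r ?maxxx ?normr0 ?addr0//.
  set s := \sum_(i <= l < n) _ in thw *.
  have m0 : 0 <= Num.max s 0 by rewrite le_max lexx orbT.
  by rewrite ger0_norm// /Num.max; case: ifPn; case: ifPn; rewrite -?leNgt; lra.
have [iN [_ cN]] := local_martingale_centered P n F hF N i hi mN' lN iNi iNp.
have iNabs : integrable_rv P (fun w => `|N n w|) by exact: (integrable_norm iN).
(* From above [theta i] is controlled by [Y i - N n], now integrable, and from below by its negative
   part. *)
have iAth : integrable_rv P (fun w => \1_A w * theta i w).
  apply: (integrable_rv_le_ae P _ _ _ _
    (integrable_rvD P _ _ (integrable_rvD P _ _ iYn iNabs) ineg)).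
    exact: measurable_funM.
  apply: filterS hH => w thw; rewrite /N indicE.
  case: (_ \in _); rewrite ?mul1r ?mul0r ?normr0 ?addr0//.
  set s := \sum_(i <= l < n) _ in thw *.
  have := ler_norm (Y i w); have := ler_norm (- s); rewrite normrN => h1 h2.
  have := normr_ge0 s; have := normr_ge0 (Y i w); rewrite ler_norml => h3 h4.
  by apply/andP; split; rewrite /Num.max; case: ifPn; rewrite -?leNgt; lra.
have iAY : integrable_rv P (fun w => \1_A w * Y i w).
  apply: (integrable_rv_boundedM P 1) => // w.
  by rewrite indicE; case: (_ \in _); rewrite ?normr1 ?normr0.
split.
  apply/integrable_mkcond => //; apply: eq_integrable iAth => // w _.
  by rewrite patchE /= indicE; case: (_ \in _); rewrite ?mul1r ?mul0r.
rewrite (integral_rv_indic P A (theta i)) (integral_rv_indic P A (Y i)).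
have cN0 : (\int[P]_w (N n w)%:E = 0)%E.
  have FT : F i setT by apply/(sub_measurableP _ (salg hi)).
  by rewrite -(cN _ FT); apply: eq_integral => w _; rewrite Ni0 subr0.
(* As [N n] has mean zero, subtracting it leaves the integral unchanged and lets the almost sure
   transform bound be integrated. *)
have -> : (\int[P]_w (\1_A w * Y i w)%:E = \int[P]_w (\1_A w * Y i w - N n w)%:E)%E.
  under [RHS]eq_integral do rewrite EFinB.
  by rewrite integralB// [X in (_ - X)%E]cN0 sube0.
apply: (le_integral_rv_ae P _ _ iAth); first exact: integrable_rvB.
apply: filterS hH => w thw; rewrite /N indicE.
by case: (_ \in _); rewrite ?mul1r ?mul0r ?subr0.
Qed.

End UpperBound.

End Bsde.

(** An essential supremum is determined only up to null sets, so the inner one enters as an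
    arbitrary choice of versions [Z tau]. Its minimality yields the upper bound, and its bounding
    property at [tau_s] yields the lower bound. *)
Theorem theorem5p2
  (R : realType) (d : measure_display) (T : measurableType d)
  (P : probability T R) (n D : nat) (hn : (0 < n)%N) (hD : (0 < D)%N)
  (F : nat -> set (set T)) (hF : filtration n F)
  (CE : nat -> (T -> \bar R) -> T -> \bar R) (hCE : cond_exp_op P n F CE)
  (Delta : nat -> R) (hDelta : forall i, (i < n)%N -> 0 < Delta i)
  (S : nat -> T -> \bar R)
  (hS_adapt : forall i, (i <= n)%N -> measurable_wrt (F i) (S i))
  (hS_ninfty : forall i w, (i <= n)%N -> S i w != +oo%E)
  (hS_n : forall w, S n w \is a fin_num)
  (hS_int : forall i, (i < n)%N ->
     P.-integrable setT (fun w => if S i w == -oo%E then 0%E else S i w))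
  (hS_n_int : P.-integrable setT (S n))
  (f : T -> nat -> R -> ('I_D -> R) -> R)
  (hf_adapt : forall i y z, (i < n)%N -> measurable_wrt (F i) (fun w => f w i y z))
  (hf_int : forall i, (i < n)%N -> integrable_rv P (fun w => f w i 0 (fun _ => 0)))
  (alpha0 : nat -> T -> R) (alpha : 'I_D -> nat -> T -> R)
  (halpha0_adapt : adapted_upto n F alpha0)
  (halpha_adapt : forall k, adapted_upto n F (alpha k))
  (halpha0_ge0 : forall i w, 0 <= alpha0 i w)
  (halpha_ge0 : forall k i w, 0 <= alpha k i w)
  (hlip : forall i w y y' (z z' : 'I_D -> R), (i < n)%N ->
     `|f w i y z - f w i y' z'|
       <= alpha0 i w * `|y - y'| + \sum_(k < D) alpha k i w * `|z k - z' k|)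
  (beta : nat -> T -> 'I_D -> R)
  (hbeta_adapt : forall i k, (1 <= i <= n)%N ->
     measurable_wrt (F i) (fun w => beta i w k))
  (hbeta_bdd : exists C : R, forall i w k, (1 <= i <= n)%N -> `|beta i w k| <= C)
  (hcontr : forall i, (i < n)%N -> {ae P, forall w,
     alpha0 i w < 1 / Delta i /\
     \sum_(k < D) alpha k i w * `|beta i.+1 w k| <= 1 / Delta i})
  (hconcave : forall w i, (i < n)%N -> forall (lam : R) y1 y2 (z1 z2 : 'I_D -> R),
     0 <= lam <= 1 ->
     lam * f w i y1 z1 + (1 - lam) * f w i y2 z2
       <= f w i (lam * y1 + (1 - lam) * y2) (fun k => lam * z1 k + (1 - lam) * z2 k))
  (Y : nat -> T -> R)
  (hY_adapt : adapted_upto n F Y)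
  (hY_int : forall i, (i <= n)%N -> integrable_rv P (Y i))
  (hY_n : {ae P, forall w, (Y n w)%:E = S n w})
  (hY_rec : forall i, (i < n)%N -> {ae P, forall w,
     (Y i w)%:E = Order.max (S i w) (cont_value CE f beta Delta Y i w)%:E})
  (i : nat) (hi : (i <= n)%N) :
  let Fam (tau : T -> nat) : set (T -> \bar R) :=
    [set X | exists M0 M theta,
       [/\ mart_pairs P n D F CE alpha M0 M,
           theta_low P S f beta Delta i tau M0 M theta &
           X = condE CE i (EFin \o theta i)]] in
  let tau_s := tau_star n CE S f beta Delta Y i in
  let M0_s := doob CE Y in
  let M_s := fun j w (k : 'I_D) => doob CE (fun j' w' => beta j' w' k * Y j' w') j w in
  (forall Z : (T -> nat) -> T -> \bar R,
     (forall tau, barS n F S i tau -> is_ess_sup P (Fam tau) (Z tau)) ->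
     is_ess_sup P [set Z tau | tau in barS n F S i] (EFin \o Y i)) /\
  [/\ barS n F S i tau_s,
      mart_pairs P n D F CE alpha M0_s M_s &
      forall theta, theta_low P S f beta Delta i tau_s M0_s M_s theta ->
        {ae P, forall w, theta i w = Y i w}].
Proof.
move=> Fam tau_s M0_s M_s.
have hbarS : barS n F S i tau_s.
  exact: (tau_star_barS P n D F hF CE hCE Delta S hS_adapt hS_n f hf_adapt alpha0 alpha
    hlip beta hbeta_adapt hbeta_bdd Y hY_adapt hY_int i hi).
have hmart : mart_pairs P n D F CE alpha M0_s M_s.
  exact: (doob_mart_pairs P n D F hF CE hCE Delta alpha0 alpha halpha_adapt halpha_ge0
    beta hbeta_adapt hbeta_bdd hcontr Y hY_adapt hY_int).
have mYi : measurable_fun setT (EFin \o Y i).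
  by apply/measurable_EFinP; apply: (integrable_rv_measurable P); exact: hY_int.
split; last first.
  split => // theta.
  exact: (theta_low_tau_star P n D CE Delta hDelta S f alpha0 alpha hlip beta hcontr Y
    hY_n hY_rec i hi).
move=> Z hZ; split; [exact: mYi|split].
  move=> _ [tau htau <-]; have [_ [_ lZ]] := hZ tau htau.
  apply: lZ => // X [M0 [M [theta [hM hth ->]]]].
  exact: (theta_low_le P n D F hF CE hCE Delta hDelta S f hf_adapt alpha0 alpha hlip
    beta hbeta_adapt hbeta_bdd hcontr Y hY_adapt hY_int hY_n hY_rec i hi hconcave
    tau M0 M theta htau hM hth).
move=> Z' mZ' ZZ'.
have h1 : {ae P, forall w, (Z tau_s w <= Z' w)%E} by apply: ZZ'; exists tau_s.
(* The member of the family generated by [Y] itself; since [Y i] is [F i]-measurable, its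
   conditional expectation is [Y i] almost surely, so every competing bound [Z'] dominates [Y i]. *)
pose X0 := condE CE i (EFin \o (fun j => if (j <= n)%N then Y j else fun=> 0) i).
have h2 : {ae P, forall w, (X0 w <= Z tau_s w)%E}.
  have [_ [uZ _]] := hZ tau_s hbarS; apply: uZ.
  exists M0_s, M_s, (fun j => if (j <= n)%N then Y j else fun=> 0); split => //.
  exact: (theta_low_Y P n D CE Delta S f beta Y hY_int hY_n hY_rec i hi).
have salg := filtration_sigma_algebra n F hF hi.
have subm := filtration_sub n F hF hi.
have cexp := filtration_condexp P n F CE hCE hi.
have h3 := condE_ae P _ salg subm _ _ cexp _ (hY_int i hi).
have h4 : {ae P, forall w, condER CE i (Y i) w = Y i w}.
  apply: (condER_unique P _ salg subm _ _ cexp); [exact: hY_int|exact: hY_adapt|].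
  by under eq_fun do rewrite subrr; exact: centered0.
rewrite /X0 hi in h2.
apply: filterS3 (filterI h1 h2) h3 h4 => w [a1 a2] a3 a4.
by rewrite /= -a4 -a3; exact: le_trans a2 a1.
Qed.
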